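(* Let $C$ be a finite connected block path, and suppose that there is a countable weakly universal $C$-free graph. Then every block of $C$ is a complete graph.
   Context: Graphs are simple and undirected. A graph $\Gamma$ is $C$-free if it contains no subgraph (not necessarily induced) isomorphic to $C$. A countable $C$-free graph $\Gamma$ is weakly universal if every countable $C$-free graph is isomorphic to a (not necessarily induced) subgraph of $\Gamma$. The blocks of a graph are its maximal 2-connected subgraphs, with the usual convention that a bridge (a single edge $K_2$ lying in no cycle) also counts as a block. The tree of blocks of a connected graph has as its vertices the blocks and the cut vertices of the graph, with a cut vertex adjacent to a block when it lies in it. A block path is a connected graph whose tree of blocks is a path; that is, its blocks can be listed as $B_1,\dots,B_\ell$ so that $B_i\cap B_{i+1}=\{v_i\}$ for $1\le i<\ell$, where $v_1,\dots,v_{\ell-1}$ are distinct and are precisely the cut vertices, and non-consecutive blocks are disjoint. *)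

(* Defs.v *)
From mathcomp Require Import all_boot.

Set Implicit Arguments.
Unset Strict Implicit.
Unset Printing Implicit Defensive.

Record sgraph (V : Type) := SGraph {
  adj :> rel V;
  adj_sym : symmetric adj;
  adj_irr : irreflexive adj
}.

(* [G] has a not necessarily induced subgraph isomorphic to [H]: the subgraph
   is the image of [H] under [f]. *)
Definition has_copy (W V : Type) (H : sgraph W) (G : sgraph V) : Prop :=
  exists f : W -> V, injective f /\ {homo f : x y / H x y >-> G x y}.

Definition graph_free (T V : Type) (C : sgraph T) (G : sgraph V) : Prop :=
  ~ has_copy C G.

(* A [countType] is finite or countably infinite, possibly empty. *)
Definition weakly_universal (T : Type) (C : sgraph T)
    (V : countType) (G : sgraph V) : Prop :=
  graph_free C G /\
  forall (W : countType) (H : sgraph W), graph_free C H -> has_copy H G.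

Section Subgraphs.

Variables (T : finType) (C : sgraph T).

(* A pair (vertex set, edge set), an edge being the set of its two ends. It is
   a graph only when [is_subgraph] holds; a subgraph need not be induced. *)
Definition presubgraph : finType := ({set T} * {set {set T}})%type.

Implicit Types H K : presubgraph.

Definition vertices H : {set T} := H.1.
Definition edges H : {set {set T}} := H.2.

Definition edge_rel H : rel T := fun x y => [set x; y] \in edges H.

Definition whole : presubgraph :=
  ([set: T], [set [set p.1; p.2] | p : T * T & C p.1 p.2]).

Definition subgraph_le H K : bool :=
  (vertices H \subset vertices K) && (edges H \subset edges K).

Definition is_subgraph H : Prop :=
  subgraph_le H whole /\ {in edges H, forall e : {set T}, e \subset vertices H}.

Definition del_vertex H (v : T) : presubgraph :=
  (vertices H :\ v, [set e in edges H | v \notin e]).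

Definition is_connected H : Prop :=
  vertices H != set0 /\ {in vertices H &, forall x y, connect (edge_rel H) x y}.

Definition two_connected H : Prop :=
  [/\ 2 < #|vertices H|, is_connected H
    & {in vertices H, forall v, is_connected (del_vertex H v)}].

Definition is_complete H : Prop :=
  {in vertices H &, forall x y, x != y -> edge_rel H x y}.

(* Every cycle through the edge xy can be listed starting with x, y. *)
Definition edge_on_cycle (x y : T) : Prop :=
  exists (z : T) (p : seq T), ucycle C [:: x, y, z & p].

Definition is_bridge H : Prop :=
  exists x y : T, [/\ C x y, ~ edge_on_cycle x y
                    & H = ([set x; y], [set [set x; y]])].

Definition max_two_connected H : Prop :=
  [/\ is_subgraph H, two_connected H
    & forall K, is_subgraph K -> two_connected K -> subgraph_le H K -> K = H].

Definition is_block H : Prop := max_two_connected H \/ is_bridge H.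

Definition cut_vertex (v : T) : Prop :=
  exists x y : T, [/\ x != v, y != v, connect C x y
                    & ~~ connect (edge_rel (del_vertex whole v)) x y].

(* The number of blocks is l.+1; [widen_ord (leqnSn l) i] and [lift ord0 i]
   are the positions i and i + 1 in the list of blocks. *)
Definition block_path : Prop :=
  is_connected whole /\
  exists (l : nat) (B : 'I_l.+1 -> presubgraph) (v : 'I_l -> T),
    [/\ injective B /\ (forall H, is_block H <-> exists i, H = B i),
        injective v /\ (forall x, cut_vertex x <-> exists i, x = v i),
        forall i : 'I_l,
          vertices (B (widen_ord (leqnSn l) i))
            :&: vertices (B (lift ord0 i)) = [set v i]
      & forall i j : 'I_l.+1, i.+1 < j ->
          [disjoint vertices (B i) & vertices (B j)]].

End Subgraphs.

(* Main.v *)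
Require Import Defs.
From mathcomp Require Import all_boot.
From mathcomp Require Import boolp zify.

Set Implicit Arguments.
Unset Strict Implicit.
Unset Printing Implicit Defensive.

(** Blocks are pruned from both ends of [C] until an end block is incomplete: if
    [k] is the least size of an end block, attach to every vertex of a graph
    infinitely many [k]-cliques, sharing only that vertex; by size, a copy of
    [C] uses them only for its smallest end blocks.

    Let then the first block [X] be incomplete, with [n] vertices. A universal
    graph [G] is defeated by a diagonal argument. Take an [n - 1]-uniform
    hypergraph of high girth on the natural numbers, replace every hyperedge by
    a clique, and attach to every vertex one copy of the other blocks of [C], in
    order. The result is [C]-free. An [n - 2]-clique has boundedly many
    completions in [G], since two completions give a complete graph on [n]
    vertices less an edge. So, if every new vertex comes with a hyperedge through
    [n - 2] old ones, an embedding in [G] is known, up to finitely many choices,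
    from its values on the initial vertices, and suitable further hyperedges
    exclude these choices. There are countably many initial values; they are
    excluded one after the other. *)

(** * Chains of blocks *)

(** The tails exist for the sake of the bound on completions. Two completions of one clique only
    yield the first block in [G]; the rest of [C] must already hang from its root for a forbidden
    copy to arise. The price is that [C] might now sit partly inside the tails, and excluding this
    is the delicate point of freeness. High girth forces the image of a 2-connected set in the core
    into a single hyperedge, which is too small for the first block. Bounded degree keeps balls
    bounded, so that far-apart points for further hyperedges never run out. A further hyperedge
    excludes values as follows: its last point [j] may be any of [q] old vertices, and in [G] the
    value at [j] must complete the clique of the values at the other points. As completions are few,
    a given tuple of values is compatible with few [j]; on average over [j], most tuples die. *)

Section Chains.

Variables (T : finType) (C : sgraph T).
Implicit Types (X Y D : {set T}) (xs ys : seq {set T}).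

(** Connectivity is phrased as an invariance principle: a property that spreads along the edges
    inside [X] passes from one vertex to all. Later arguments, such as an image staying in one
    fibre, use it directly, without paths. The empty set qualifies. *)
Definition conn X := forall (P : T -> Prop) v w, v \in X -> w \in X -> P v ->
  (forall a b, a \in X -> b \in X -> C a b -> P a -> P b) -> P w.

(** Maximality is left out, and a single edge qualifies because one vertex is connected; bridges and
    2-connected blocks are thus handled alike. *)
Definition blk X := [/\ 1 < #|X|, conn X & forall c, conn (X :\ c)].

Definition span xs : {set T} := [set u | has (fun X => u \in X) xs].

(** Edges are controlled within [span xs] only, so a contiguous sublist is a chain for the same [C],
    and pruning never has to restrict the graph. *)
Record chain xs : Prop := Chain {
  chain_blk : forall X, X \in xs -> blk X;
  chain_cap : forall a b, a < b < size xs ->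
    #|nth set0 xs a :&: nth set0 xs b| = (b == a.+1);
  chain_edge : forall u w, u \in span xs -> w \in span xs -> C u w ->
    exists X, [/\ X \in xs, u \in X & w \in X] }.

(** The default [x0] is returned only if the two blocks are disjoint, which a chain rules out for
    [0 < a < size xs]. *)
Definition cutv (x0 : T) xs a :=
  odflt x0 [pick u in nth set0 xs a.-1 :&: nth set0 xs a].

(** A block glued on at one vertex adds [#|X|.-1] vertices; unlike the size of the span, this count
    is additive under concatenation. *)
Definition excess xs := sumn [seq #|X|.-1 | X : {set T} <- xs].

Lemma spanP u xs :
  reflect (exists2 a, a < size xs & u \in nth set0 xs a) (u \in span xs).
Proof. by rewrite inE; apply: (iffP (has_nthP set0)). Qed.

Lemma mem_span X xs u : X \in xs -> u \in X -> u \in span xs.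
Proof. by move=> Xxs uX; rewrite inE; apply/hasP; exists X. Qed.

Lemma span_cons X xs : span (X :: xs) = X :|: span xs.
Proof. by apply/setP=> u; rewrite !inE. Qed.

Lemma span_cat xs ys : span (xs ++ ys) = span xs :|: span ys.
Proof. by apply/setP=> u; rewrite !inE has_cat. Qed.

Lemma span_rev xs : span (rev xs) = span xs.
Proof. by apply/setP=> u; rewrite !inE has_rev. Qed.

Lemma connU X Y z : z \in X -> z \in Y -> conn X -> conn Y -> conn (X :|: Y).
Proof.
move=> zX zY cX cY P v w; rewrite !inE => vXY wXY Pv cl.
have clX a b : a \in X -> b \in X -> C a b -> P a -> P b.
  by move=> aX bX; apply: cl; rewrite inE ?aX ?bX.
have clY a b : a \in Y -> b \in Y -> C a b -> P a -> P b.
  by move=> aX bX; apply: cl; rewrite inE ?aX ?bX orbT.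
have Pz : P z by case/orP: vXY => vX; [apply: (cX P v)|apply: (cY P v)].
by case/orP: wXY => wX; [apply: (cX P z)|apply: (cY P z)].
Qed.

Lemma conn_nbr X u : conn X -> 1 < #|X| -> u \in X -> exists2 w, w \in X & C u w.
Proof.
move=> cX X2 uX; apply: contrapT => nw.
have [w wX wu] : exists2 w, w \in X & w != u.
  have : 0 < #|X :\ u| by move: X2; rewrite (cardsD1 u) uX.
  by case/card_gt0P=> w; rewrite !inE => /andP[wu wX]; exists w.
suff E : u = w by rewrite E eqxx in wu.
apply: (cX (eq u) u w) => // a b aX bX ab ua.
by exfalso; apply: nw; exists b; rewrite // ua.
Qed.

Lemma chain_adj xs a b u : chain xs -> a < b -> b < size xs ->
  u \in nth set0 xs a -> u \in nth set0 xs b -> b = a.+1.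
Proof.
move=> ch ab bs ua ub; have := chain_cap ch (a := a) (b := b).
rewrite ab bs => /(_ isT); case: eqP => // _ /eqP; rewrite cards_eq0 => /eqP E.
by move/setP/(_ u): E; rewrite !inE ua ub.
Qed.

Lemma cutvP x0 xs a : chain xs -> 0 < a -> a < size xs ->
  nth set0 xs a.-1 :&: nth set0 xs a = [set cutv x0 xs a].
Proof.
case: a => // a ch _ sa; have := chain_cap ch (a := a) (b := a.+1).
rewrite ltnSn sa eqxx => /(_ isT) /eqP/cards1P[u E].
rewrite /cutv /= E; case: pickP => [w|/(_ u)]; last by rewrite !inE eqxx.
by rewrite /= inE => /eqP->.
Qed.

Lemma chain_cap_eq x0 xs a u : chain xs -> 0 < a -> a < size xs ->
  u \in nth set0 xs a.-1 -> u \in nth set0 xs a -> u = cutv x0 xs a.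
Proof.
move=> ch a0 sa u1 u2; have := cutvP x0 ch a0 sa.
by move/setP/(_ u); rewrite !inE u1 u2 => /esym/eqP.
Qed.

Lemma cutv_mem x0 xs a : chain xs -> 0 < a -> a < size xs ->
  (cutv x0 xs a \in nth set0 xs a.-1) && (cutv x0 xs a \in nth set0 xs a).
Proof.
move=> ch a0 sa; have := cutvP x0 ch a0 sa.
by move/setP/(_ (cutv x0 xs a)); rewrite !inE eqxx.
Qed.

Lemma cutv_only x0 xs a b : chain xs -> 0 < a -> a < size xs -> b < size xs ->
  cutv x0 xs a \in nth set0 xs b -> b = a.-1 \/ b = a.
Proof.
move=> ch a0 sa sb vb; have /andP[va' va] := cutv_mem x0 ch a0 sa.
case: (ltngtP b a) => [ba|ab|]; last by right.
  by left; have := chain_adj ch ba sa vb va; lia.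
have sa' : a.-1 < b by lia.
by have := chain_adj ch sa' sb va' vb; lia.
Qed.

Lemma cutv_inj x0 xs a b : chain xs -> 0 < a -> a < size xs -> 0 < b ->
  b < size xs -> cutv x0 xs a = cutv x0 xs b -> a = b.
Proof.
move=> ch a0 sa b0 sb E; have /andP[va' va] := cutv_mem x0 ch a0 sa.
have /andP[vb' vb] := cutv_mem x0 ch b0 sb; rewrite -E in vb' vb.
have := cutv_only ch a0 sa sb vb.
have sb' : b.-1 < size xs by lia.
have := cutv_only ch a0 sa sb' vb'; lia.
Qed.

Lemma chain_edge_nth xs u w : chain xs -> u \in span xs -> w \in span xs ->
  C u w -> exists c, [/\ c < size xs, u \in nth set0 xs c & w \in nth set0 xs c].
Proof.
move=> ch us ws uw; have [X [/(nthP set0)[c cs <-] uX wX]] := chain_edge ch us ws uw.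
by exists c.
Qed.

(* Two blocks share at most one vertex, so no edge joins two vertices of a
   block outside the chosen range of indices. *)
Lemma chain_slice xs ys k : chain xs -> k + size ys <= size xs ->
  (forall a, a < size ys -> nth set0 ys a = nth set0 xs (k + a)) -> chain ys.
Proof.
move=> ch sz E; split.
- move=> X /(nthP set0)[a sa <-]; rewrite E //; apply: (chain_blk ch).
  by apply: mem_nth; apply: leq_trans sz; rewrite ltn_add2l.
- move=> a b /andP[ab sb]; have sa := ltn_trans ab sb; rewrite !E //.
  rewrite (chain_cap ch); last lia.
  by congr nat_of_bool; apply/eqP/eqP; lia.
- move=> u w /spanP[a sa ua] /spanP[b sb wb] uw.
  rewrite E // in ua; rewrite E // in wb.
  have us : u \in span xs by apply/spanP; exists (k + a) => //; lia.
  have ws : w \in span xs by apply/spanP; exists (k + b) => //; lia.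
  have [c [sc uc wc]] := chain_edge_nth ch us ws uw.
  case: (ltnP c k) => [ck|kc].
    have la : c < k + a by lia.
    have lb : c < k + b by lia.
    have Ea : k + a = c.+1 by apply: (chain_adj ch la _ uc ua); lia.
    have Eb : k + b = c.+1 by apply: (chain_adj ch lb _ wc wb); lia.
    rewrite Ea in ua; rewrite Eb in wb.
    have sc' : c.+1 < size xs by lia.
    by move: uw; rewrite (chain_cap_eq u ch _ sc' uc ua) //
       (chain_cap_eq u ch _ sc' wc wb) // adj_irr.
  case: (ltnP c (k + size ys)) => [cs|sc'].
    have sck : c - k < size ys by lia.
    by exists (nth set0 ys (c - k)); rewrite E // subnKC //; split=> //;
       rewrite -{1}(subnKC kc) -E //; apply: mem_nth.
  have la : k + a < c by lia.
  have lb : k + b < c by lia.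
  have Ea := chain_adj ch la sc ua uc; have Eb := chain_adj ch lb sc wb wc.
  have ua' : u \in nth set0 xs c.-1 by rewrite Ea.
  have wb' : w \in nth set0 xs c.-1 by rewrite Eb.
  have c0 : 0 < c by lia.
  by move: uw; rewrite (chain_cap_eq u ch c0 sc ua' uc)
     (chain_cap_eq u ch c0 sc wb' wc) adj_irr.
Qed.

Lemma chain_take i xs : chain xs -> chain (take i xs).
Proof.
move=> ch; apply: (chain_slice (k := 0) ch) => [|a]; rewrite size_take_min; first lia.
by move=> sa; rewrite nth_take //; lia.
Qed.

Lemma chain_drop i xs : chain xs -> chain (drop i xs).
Proof.
move=> ch; case: (leqP i (size xs)) => is_.
  apply: (chain_slice (k := i) ch) => [|a]; rewrite size_drop; first lia.
  by move=> sa; rewrite nth_drop.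
by rewrite drop_oversize ?(ltnW is_) //; split=> [X|a b|u w]; rewrite ?inE ?andbF.
Qed.

Lemma chain_rev xs : chain xs -> chain (rev xs).
Proof.
move=> ch; split.
- by move=> X; rewrite mem_rev; apply: (chain_blk ch).
- move=> a b; rewrite size_rev => /andP[ab bs].
  rewrite !nth_rev //; last lia.
  rewrite setIC (chain_cap ch); last lia.
  by congr nat_of_bool; apply/eqP/eqP; lia.
- move=> u w; rewrite !span_rev => us ws uw.
  have [X [Xs uX wX]] := chain_edge ch us ws uw.
  by exists X; rewrite mem_rev.
Qed.

Lemma chain_head_cap X xs : chain (X :: xs) -> 0 < size xs ->
  X :&: span xs = X :&: nth set0 xs 0.
Proof.
move=> ch s0; apply/setP=> u; rewrite !in_setI; case uX: (u \in X) => //=.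
apply/idP/idP => [/spanP[a sa ua]|u0]; last by apply/spanP; exists 0.
have := @chain_adj _ 0 a.+1 u ch; rewrite /= ltnS => H.
by have [Ea] := H isT sa uX ua; rewrite -Ea.
Qed.

(** Deleting nothing and deleting one vertex are treated at once: each block stays connected, and
    consecutive blocks stay glued because their common vertex is not in [D]. *)
Lemma conn_spanD xs D : chain xs -> D = set0 \/ (exists c, D = [set c]) ->
  (forall a, 0 < a -> a < size xs ->
     ~~ (nth set0 xs a.-1 :&: nth set0 xs a \subset D)) ->
  conn (span xs :\: D).
Proof.
move=> ch D1; elim: xs ch => [|X xs IH] ch nD.
  have -> : span [::] :\: D = set0 by apply/setP=> u; rewrite !inE andbF.
  by move=> P v w; rewrite inE.
have cX : conn (X :\: D).
  have [_ h1 h2] := chain_blk ch (mem_head X xs).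
  by case: D1 => [->|[c ->]] //; rewrite setD0.
have chs : chain xs by have := chain_drop 1 ch; rewrite /= drop0.
case: (posnP (size xs)) => [/eqP|s0].
  by rewrite size_eq0 => /eqP ->; rewrite span_cons (_ : span [::] = set0) ?setU0 //;
     apply/setP=> u; rewrite !inE.
have cxs : conn (span xs :\: D).
  by apply: IH => // a a0 sa; have := nD a.+1; rewrite /= ltnS -{3}(prednK a0); apply.
have := nD 1; rewrite /= ltnS => /(_ isT s0) /subsetPn[z].
rewrite inE => /andP[zX z0] zD.
rewrite span_cons setDUl; apply: (@connU _ _ z) => //; rewrite !inE zD //=.
by apply/(has_nthP set0); exists 0.
Qed.

Lemma conn_span xs : chain xs -> conn (span xs).
Proof.
move=> ch; rewrite -[span xs]setD0; apply: conn_spanD => // [|a a0 sa]; first by left.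
rewrite subset0 -cards_eq0 (chain_cap ch); last lia.
by rewrite prednK ?eqxx.
Qed.

Lemma conn_spanD1 x0 xs c : chain xs ->
  (forall a, 0 < a -> a < size xs -> cutv x0 xs a != c) -> conn (span xs :\ c).
Proof.
move=> ch nc; apply: conn_spanD => // [|a a0 sa]; first by right; exists c.
by rewrite (cutvP x0) // sub1set inE nc.
Qed.

Lemma cutv_take x0 xs i a : a < i -> cutv x0 (take i xs) a = cutv x0 xs a.
Proof. by move=> ai; rewrite /cutv !nth_take //; lia. Qed.

Lemma conn_head x0 xs i : chain xs -> 0 < i -> i < size xs ->
  conn (span (take i xs) :\ cutv x0 xs i).
Proof.
move=> ch i0 si; apply: (@conn_spanD1 x0) => [|a a0]; first exact: chain_take.
rewrite size_take si => ai; rewrite cutv_take //; apply/eqP=> E.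
have sa : a < size xs by lia.
by have := cutv_inj ch a0 sa i0 si E; lia.
Qed.

Lemma conn_tail x0 xs i : chain xs -> 0 < i -> i < size xs ->
  conn (span (drop i xs) :\ cutv x0 xs i).
Proof.
move=> ch i0 si; apply: (@conn_spanD1 x0) => [|a a0]; first exact: chain_drop.
rewrite size_drop => ai.
have -> : cutv x0 (drop i xs) a = cutv x0 xs (i + a).
  by rewrite /cutv !nth_drop -!subn1 addnBA.
apply/eqP=> E; have sa : i + a < size xs by lia.
have sa0 : 0 < i + a by lia.
by have := cutv_inj ch sa0 sa i0 si E; lia.
Qed.

Lemma span_take_drop i xs : span xs = span (take i xs) :|: span (drop i xs).
Proof. by rewrite -span_cat cat_take_drop. Qed.

Lemma take_drop_cap x0 xs i : chain xs -> 0 < i -> i < size xs ->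
  span (take i xs) :&: span (drop i xs) = [set cutv x0 xs i].
Proof.
move=> ch i0 si; apply/setP=> u; rewrite !inE; apply/idP/eqP.
  case/andP=> /(has_nthP set0)[a]; rewrite size_take si => ai.
  rewrite nth_take // => ua /(has_nthP set0)[b]; rewrite size_drop nth_drop => sb ub.
  have ab : a < i + b by lia.
  have sb' : i + b < size xs by lia.
  have E := chain_adj ch ab sb' ua ub.
  apply: (chain_cap_eq x0 ch i0 si).
    by have -> : i.-1 = a by lia.
  by have <- : i + b = i by lia.
move=> ->; have /andP[h1 h2] := cutv_mem x0 ch i0 si.
apply/andP; split; apply/(has_nthP set0).
  by exists i.-1; rewrite ?size_take ?si ?nth_take //; lia.
by exists 0; rewrite ?size_drop ?nth_drop ?addn0 //; lia.
Qed.

Lemma cutv_take_mem x0 xs i a : chain xs -> 0 < i -> i < size xs -> 0 < a ->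
  a < size xs -> cutv x0 xs a \in span (take i xs) -> a <= i.
Proof.
move=> ch i0 si a0 sa /spanP[b]; rewrite size_take si => bi.
rewrite nth_take // => vb; have sb : b < size xs by lia.
by have := cutv_only ch a0 sa sb vb; lia.
Qed.

Lemma cutv_notin_drop x0 xs a b : chain xs -> 0 < a -> a < size xs -> a < b ->
  cutv x0 xs a \notin span (drop b xs).
Proof.
move=> ch a0 sa ab; apply/negP=> /spanP[c]; rewrite size_drop nth_drop => sc vc.
have sb : b + c < size xs by lia.
by have := cutv_only ch a0 sa sb vc; lia.
Qed.

Lemma card_span xs : chain xs -> xs != [::] -> #|span xs| = (excess xs).+1.
Proof.
elim: xs => // X xs IH ch _.
have [X2 _ _] := chain_blk ch (mem_head X xs).
rewrite span_cons /excess /= -/(excess xs).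
case: (posnP (size xs)) => [/eqP|s0].
  rewrite size_eq0 => /eqP ->; rewrite (_ : span [::] = set0) ?setU0 ?/excess /=; first lia.
  by apply/setP=> u; rewrite !inE.
have chs : chain xs by have := chain_drop 1 ch; rewrite /= drop0.
rewrite cardsU chain_head_cap // IH //; last by rewrite -size_eq0 -lt0n.
have := chain_cap ch (a := 0) (b := 1); rewrite /= ltnS s0 => -> //=; lia.
Qed.

Lemma excess_cat xs ys : excess (xs ++ ys) = excess xs + excess ys.
Proof. by rewrite /excess map_cat sumn_cat. Qed.

Lemma excess_take_lt xs i j : chain xs -> i < j -> j <= size xs ->
  excess (take i xs) < excess (take j xs).
Proof.
move=> ch ij sj; have -> : take i xs = take i (take j xs).
  by rewrite take_takel // ltnW.
rewrite -{2}(cat_take_drop i (take j xs)) excess_cat -{1}[excess _]addn0 ltn_add2l.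
have si : i < size (take j xs) by rewrite size_take_min; lia.
rewrite (drop_nth set0) // /excess /=.
have [h _ _] := chain_blk (chain_take j ch) (mem_nth set0 si).
by rewrite addn_gt0 -subn1 subn_gt0 h.
Qed.

End Chains.

(** * Pruning end blocks *)

Section Pruning.

Variables (T : finType) (C : sgraph T).
Implicit Types (X Y D : {set T}) (xs ys : seq {set T}).

Definition emb D (V : Type) (G : sgraph V) (M : V -> Prop) (f : T -> V) :=
  [/\ {in D &, injective f}, {in D &, forall u w, C u w -> G (f u) (f w)}
    & forall u, u \in D -> M (f u)].

Definition free_of D (V : Type) (G : sgraph V) (M : V -> Prop) :=
  forall f, ~ emb D G M f.

(* The predicate [M] plays the role of an induced subgraph of [G]; it avoids
   building subtypes when the universal graph is thinned out by pruning. *)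
Definition has_universal xs := exists (V : countType) (G : sgraph V) (M : V -> Prop),
  free_of (span xs) G M /\
  forall (W : countType) (H : sgraph W), free_of (span xs) H (fun=> True) ->
    exists g : W -> V, [/\ injective g, {homo g : x y / H x y >-> G x y}
                         & forall w, M (g w)].

(** Avoiding an arbitrary finite [F] expresses that infinitely many disjoint [k]-cliques are
    attached at [x]. *)
Definition petals (V : eqType) (G : sgraph V) (M : V -> Prop) k x :=
  forall F : seq V, exists q : seq V,
    [/\ uniq q, size q = k, {in x :: q &, forall y z, y != z -> G y z}
      & forall y, y \in q -> M y /\ y \notin F].

(** A clique of size [#|X|.-1] completely joined to [f c] hosts any graph on [X]; taking the image
    of [D] as the set to avoid makes its vertices new. *)
Lemma attach_petal (V : countType) (G : sgraph V) M D X c f :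
  emb D G M f -> X :&: D = [set c] ->
  (forall u w, u \in D :|: X -> w \in D :|: X -> C u w ->
     (u \in D) && (w \in D) || (u \in X) && (w \in X)) ->
  petals G M #|X|.-1 (f c) ->
  exists f', emb (D :|: X) G M f' /\ {in D, f' =1 f}.
Proof.
move=> [fi fh fM] XD edge /(_ [seq f u | u <- enum D])[q [qu qs qc qM]].
have /andP[cX cD] : (c \in X) && (c \in D) by rewrite -in_setI XD inE.
pose g u := if u \in D then f u else nth (f c) q (index u (enum (X :\ c))).
have gD : {in D, g =1 f} by move=> u uD; rewrite /g uD.
have uXD u : u \in X -> u \notin D -> u \in enum (X :\ c).
  by move=> uX uD; rewrite mem_enum !inE uX andbT; apply: contraNneq uD => ->.
have szX : size (enum (X :\ c)) = size q by rewrite -cardE qs (cardsD1 c X) cX.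
have gX u : u \in X -> u \notin D -> g u \in q.
  move=> uX uD; rewrite /g (negPf uD); apply: mem_nth.
  by rewrite -szX index_mem uXD.
have gnF u w : u \in X -> u \notin D -> w \in D -> g u != f w.
  move=> uX uD wD; have [_ nF] := qM _ (gX _ uX uD).
  by apply: contraNneq nF => ->; apply/mapP; exists w => //; rewrite mem_enum.
have gi : {in D :|: X &, injective g}.
  move=> u w; rewrite !inE; case uD: (u \in D); case wD: (w \in D) => //=.
  - by move=> _ _; rewrite !gD //; apply: fi.
  - move=> _ wX E; have := gnF w u wX (negbT wD) uD.
    by rewrite -E gD // eqxx.
  - move=> uX _ E; have := gnF u w uX (negbT uD) wD.
    by rewrite E gD // eqxx.
  move=> uX wX; rewrite /g uD wD => /eqP.
  rewrite nth_uniq // -?szX ?index_mem ?uXD ?uD ?wD // => /eqP E.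
  have Eu := nth_index c (uXD u uX (negbT uD)).
  by rewrite -Eu E nth_index // uXD // wD.
have gXc u : u \in X -> g u \in f c :: q.
  move=> uX; case uD: (u \in D); last by rewrite inE gX ?orbT ?uD.
  have : u \in X :&: D by rewrite inE uX.
  by rewrite XD inE => /eqP->; rewrite gD // mem_head.
exists g; split=> //; split=> //.
- move=> u w uDX wDX uw; case/orP: (edge _ _ uDX wDX uw) => /andP[uX wX].
    by rewrite !gD //; apply: fh.
  apply: qc; rewrite ?gXc //; apply: contraTneq uw => E.
  by rewrite (gi u w uDX wDX E) adj_irr.
- move=> u; rewrite inE; case uD: (u \in D) => /= uX; first by rewrite gD //; apply: fM.
  by have [] := qM _ (gX u uX (negbT uD)).
Qed.

(** [inr (x, (j, s))] is the vertex [s] of the [j]-th petal at [x]; every vertex of [H] gets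
    countably many petals. *)
Definition petal_rel (W : eqType) (H : rel W) k : rel (W + W * (nat * 'I_k)) :=
  fun p q => match p, q with
    | inl x, inl y => H x y
    | inl x, inr y => x == y.1
    | inr x, inl y => x.1 == y
    | inr x, inr y => [&& x.1 == y.1, x.2.1 == y.2.1 & x.2.2 != y.2.2]
    end.

Lemma petal_sym (W : eqType) (H : sgraph W) k : symmetric (@petal_rel W H k).
Proof.
move=> [x|x] [y|y] //=; first exact: adj_sym.
by congr [&& _, _ & ~~ _]; apply: eq_sym.
Qed.

Lemma petal_irr (W : eqType) (H : sgraph W) k : irreflexive (@petal_rel W H k).
Proof. by move=> [x|x] /=; rewrite ?adj_irr ?eqxx ?andbF. Qed.

Definition petal_graph (W : eqType) (H : sgraph W) k :=
  SGraph (@petal_sym W H k) (@petal_irr W H k).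

(** By injectivity a finite [F] meets only finitely many petals at [x], so all late enough ones
    avoid it. *)
Lemma petal_graph_petals (V W : countType) (G : sgraph V) (M : V -> Prop)
    (H : sgraph W) k (g : W + W * (nat * 'I_k) -> V) :
  injective g -> {homo g : x y / petal_graph H k x y >-> G x y} ->
  (forall w, M (g w)) -> forall x, petals G M k (g (inl x)).
Proof.
move=> gi gh gM x F.
have [j0 j0P] : exists j0, forall j s, j0 <= j -> g (inr (x, (j, s))) \notin F.
  elim: F => [|y F [j0 IH]]; first by exists 0.
  have [[j1 [s1 E]]|nE] := pselect (exists j s, y = g (inr (x, (j, s)))).
    exists (maxn j0 j1.+1) => j s; rewrite geq_max => /andP[h0 h1].
    rewrite inE negb_or IH // andbT E; apply: contraTneq h1 => /gi[->].
    by rewrite ltnn.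
  exists j0 => j s hj; rewrite inE negb_or IH // andbT; apply/eqP => E.
  by apply: nE; exists j, s.
exists [seq g (inr (x, (j0, s))) | s <- enum 'I_k]; split.
- by rewrite map_inj_uniq ?enum_uniq // => s t /gi[].
- by rewrite size_map size_enum_ord.
- move=> y z; rewrite !inE.
  case/orP=> [/eqP->|/mapP[s _ ->]]; case/orP=> [/eqP->|/mapP[t _ ->]].
  + by rewrite eqxx.
  + by move=> _; apply: gh => /=.
  + by move=> _; apply: gh => /=.
  + move=> st; apply: gh; rewrite /= !eqxx /=.
    by apply: contraNneq st => ->.
- by move=> y /mapP[s _ ->]; split; [exact: gM|exact: j0P].
Qed.

Lemma take1_span xs : 0 < size xs -> span (take 1 xs) = nth set0 xs 0.
Proof. by case: xs => // X xs _; rewrite /= take0; apply/setP=> u; rewrite !inE /= orbF. Qed.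

Lemma drop_last_span xs : 0 < size xs ->
  span (drop (size xs).-1 xs) = nth set0 xs (size xs).-1.
Proof.
move=> s0; rewrite (drop_nth set0) ?prednK // drop_size.
by apply/setP=> u; rewrite !inE /= orbF.
Qed.

Lemma span_mem_nth xs a u : a < size xs -> u \in nth set0 xs a -> u \in span xs.
Proof. by move=> sa ua; apply/spanP; exists a. Qed.

Lemma card_span_gt xs a : chain C xs -> 1 < size xs -> a < size xs ->
  #|nth set0 xs a| < #|span xs|.
Proof.
move=> ch s1 sa; have [b [sb ab]] : exists b, b < size xs /\
    #|nth set0 xs a :&: nth set0 xs b| = 1.
  have [a0|a0] := posnP a; [exists 1|exists a.-1]; split; try lia.
    by rewrite a0 (chain_cap ch).
  by rewrite setIC (chain_cap ch) ?prednK ?leqnn ?eqxx.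
have [h _ _] := chain_blk ch (mem_nth set0 sb).
have : 0 < #|nth set0 xs b :\: nth set0 xs a|.
  by rewrite cardsD setIC ab subn_gt0.
case/card_gt0P=> u; rewrite inE => /andP[ua ub]; apply: proper_card.
apply/properP; split; first by apply/subsetP=> w; apply: span_mem_nth.
by exists u => //; apply: span_mem_nth ub.
Qed.

(* A petal is left through its base, so a petal met by the image of [C] holds
   one side of a cut vertex; by size this side is an extreme block. *)
Lemma petal_image (W : countType) (H : sgraph W) x0 xs f :
  let l := (size xs).-1 in
  chain C xs -> 1 < size xs -> #|nth set0 xs 0| <= #|nth set0 xs l| ->
  emb (span xs) (petal_graph H #|nth set0 xs 0|.-1) (fun=> True) f ->
  forall u p, u \in span xs -> f u = inr p ->
    u \in nth set0 xs 0 :\ cutv x0 xs 1 \/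
    #|nth set0 xs l| <= #|nth set0 xs 0| /\ u \in nth set0 xs l :\ cutv x0 xs l.
Proof.
move=> l ch s1 sz [fi fh _] u [x [j s]] us fu.
set k := #|_|.-1 in f fi fh s fu.
have s0 : 0 < size xs by lia.
have [X02 _ _] := chain_blk ch (mem_nth set0 s0).
pose pet w := exists t : 'I_k, f w = inr (x, (j, t)).
have petu : pet u by exists s.
have step a b : a \in span xs -> b \in span xs -> C a b -> pet a -> ~ pet b ->
    f b = inl x.
  move=> aS bS ab [t ft] nb; have := fh a b aS bS ab; rewrite ft.
  case fb: (f b) => [y|[y [j' t']]] /=; first by move/eqP->.
  move=> /and3P[/eqP E1 /eqP E2 _]; exfalso; apply: nb; exists t'.
  by rewrite fb -E1 -E2.
have petcard D : D \subset span xs -> (forall w, w \in D -> pet w) -> #|D| <= k.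
  move=> DS Dp.
  pose t w := if f w is inr (_, (_, t)) then t else s.
  rewrite -[leqRHS](card_ord k) -(card_in_imset (f := t) (D := D)) ?max_card //.
  move=> a b aD bD; have [ta Ea] := Dp a aD; have [tb Eb] := Dp b bD.
  rewrite /t Ea Eb => E; apply: fi; rewrite ?(subsetP DS) //.
  by rewrite Ea Eb E.
have kX : k < #|nth set0 xs 0| by rewrite /k prednK // ltnW.
have X0S : #|nth set0 xs 0| < #|span xs| by apply: card_span_gt.
have [c0 c0S fc0] : exists2 c0, c0 \in span xs & f c0 = inl x.
  apply: contrapT => nc; have : #|span xs| <= k; last by lia.
  apply: petcard => // w wS; apply: (conn_span ch us wS) => // a b aS bS ab pa.
  by apply: contrapT => nb; apply: nc; exists b => //; apply: step pa nb.
have uc0 : u != c0 by apply: contraPneq fu => ->; rewrite fc0.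
have side D w : D \subset span xs -> conn C (D :\ c0) -> u \in D -> w \in D :\ c0 ->
    pet w.
  move=> DS cD uD wD; apply: (cD pet u w) => //; first by rewrite !inE uc0.
  move=> a b; rewrite !inE => /andP[_ /(subsetP DS) aS] /andP[bc0 /(subsetP DS) bS] ab pa.
  apply: contrapT => nb; have fb := step a b aS bS ab pa nb.
  by move: bc0; rewrite (fi b c0) ?eqxx // fb fc0.
(* Such a side lies in the petal except for [c0], which sits at the base; a petal with its base has
   exactly as many vertices as the first block. *)
have small D : D \subset span xs -> conn C (D :\ c0) -> u \in D -> c0 \in D ->
    #|D| <= #|nth set0 xs 0|.
  move=> DS cD uD c0D; rewrite (cardsD1 c0) c0D add1n.
  apply: leq_ltn_trans kX; apply: petcard => [|w wD]; last exact: side wD.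
  by apply: subset_trans DS; apply: subsetDl.
have [i [i0 si Ei]] : exists i, [/\ 0 < i, i < size xs & cutv x0 xs i = c0].
  apply: contrapT => ni.
  have := small (span xs) (subxx _) _ us c0S; rewrite leqNgt X0S => H'.
  suff: conn C (span xs :\ c0) by move/H'.
  by apply: (@conn_spanD1 _ C x0) => // a a0 sa; apply/eqP => E; apply: ni; exists a.
have capc : c0 \in span (take i xs) :&: span (drop i xs).
  by rewrite (take_drop_cap x0 ch) // Ei inE.
have /andP[c0h c0t] : (c0 \in span (take i xs)) && (c0 \in span (drop i xs)).
  by rewrite -in_setI.
have hS : span (take i xs) \subset span xs by rewrite (span_take_drop i xs) subsetUl.
have tS : span (drop i xs) \subset span xs by rewrite (span_take_drop i xs) subsetUr.
have := us; rewrite {1}(span_take_drop i xs) inE => /orP[uh|ut].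
  left; have := small _ hS; rewrite -{1}Ei => /(_ (conn_head ch i0 si) uh c0h).
  have ch1 := chain_take 1 ch; have chi := chain_take i ch.
  rewrite -(take1_span s0) (card_span ch1); last by case: (xs) s0.
  rewrite (card_span chi); last by case: (xs) i0 s0; case: (i).
  move=> le; have i1 : i = 1.
    case: (ltngtP i 1) => // [|i1]; first lia.
    by have := excess_take_lt ch i1 (ltnW si); lia.
  by rewrite i1 in uh Ei *; rewrite Ei !inE uc0; move: uh; rewrite inE.
right; have := small _ tS; rewrite -{1}Ei => /(_ (conn_tail ch i0 si) ut c0t) le.
have [il|il] := eqVneq i l.
  by rewrite il in ut le Ei; rewrite drop_last_span // in ut le; rewrite Ei !inE uc0.
have : #|nth set0 (drop i xs) (l - i)| < #|span (drop i xs)|.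
  by apply: card_span_gt; rewrite ?size_drop; [exact: chain_drop|lia|lia].
have il' : i + (l - i) = l by rewrite subnKC // /l -ltnS prednK.
by rewrite nth_drop il'; lia.
Qed.

(** The graph universal for [ys] is the part of [G] on the vertices that carry petals. [up] makes it
    free; [down] sends a free [H] into it, because the petal graph of [H] embeds in [G] and takes
    its petals along. *)
Lemma prune xs ys k : 
  (forall (V : countType) (G : sgraph V) M f,
     emb (span ys) G (fun x => M x /\ petals G M k x) f ->
     exists f', emb (span xs) G M f') ->
  (forall (W : countType) (H : sgraph W), free_of (span ys) H (fun=> True) ->
     free_of (span xs) (petal_graph H k) (fun=> True)) ->
  has_universal xs -> has_universal ys.
Proof.
move=> up down [V [G [M [Gf Gu]]]].
exists V, G, (fun x => M x /\ petals G M k x); split.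
  by move=> f /up[f' /Gf].
move=> W H /down Hf; have [g [gi gh gM]] := Gu _ _ Hf.
exists (fun w => g (inl w)); split.
- by move=> x y /gi[].
- by move=> x y xy; apply: gh.
- by move=> w; split; [exact: gM|exact: (petal_graph_petals gi gh gM)].
Qed.

Lemma emb_of_inl (W : countType) (H : sgraph W) k D f :
  emb D (petal_graph H k) (fun=> True) f ->
  (forall u p, u \in D -> f u <> inr p) ->
  exists g, emb D H (fun=> True) g.
Proof.
move=> [fi fh _] fl; pose g u := match f u with inl w => w | inr p => p.1 end.
have fg u : u \in D -> f u = inl (g u).
  by rewrite /g; case E: (f u) => [//|p] uD; case: (fl u p).
exists g; split=> //.
- by move=> u w uD wD E; apply: fi => //; rewrite !fg ?E.
- by move=> u w uD wD uw; have := fh u w uD wD uw; rewrite !fg.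
Qed.

Lemma chain_edge_cons X ys u w : chain C (X :: ys) ->
  u \in span ys :|: X -> w \in span ys :|: X -> C u w ->
  (u \in span ys) && (w \in span ys) || (u \in X) && (w \in X).
Proof.
move=> ch; rewrite setUC -span_cons => us ws uw.
have [Z [Zs uZ wZ]] := chain_edge ch us ws uw.
move: Zs; rewrite inE => /orP[/eqP <-|Zs]; first by rewrite uZ wZ orbT.
by rewrite !(mem_span Zs).
Qed.

Lemma attach_first (V : countType) (G : sgraph V) M X ys f x0 :
  chain C (X :: ys) -> 0 < size ys -> emb (span ys) G M f ->
  petals G M #|X|.-1 (f (cutv x0 (X :: ys) 1)) ->
  exists f', emb (span (X :: ys)) G M f' /\ {in span ys, f' =1 f}.
Proof.
move=> ch s0 fe fp; rewrite span_cons setUC.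
apply: attach_petal fe _ _ fp.
  by rewrite (chain_head_cap ch) //; apply: (cutvP x0 ch (a := 1)).
by move=> u w; apply: chain_edge_cons.
Qed.

Lemma emb_weak (V : Type) (G : sgraph V) (M M' : V -> Prop) D f :
  (forall x, M x -> M' x) -> emb D G M f -> emb D G M' f.
Proof. by move=> MM [fi fh fM]; split=> // u /fM/MM. Qed.

Lemma has_universal_rev xs : has_universal xs -> has_universal (rev xs).
Proof. by move=> [V [G [M hG]]]; exists V, G, M; rewrite span_rev. Qed.

Lemma prune_first X ys Y : chain C (X :: rcons ys Y) -> #|X| < #|Y| ->
  has_universal (X :: rcons ys Y) -> has_universal (rcons ys Y).
Proof.
move=> ch XY; have [x0 _] : exists x0, x0 \in Y.
  by apply/set0Pn; rewrite -card_gt0; lia.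
apply: (@prune _ _ #|X|.-1) => [V G M f fe|W H Hf f fe].
  have s0 : 0 < size (rcons ys Y) by rewrite size_rcons.
  have feM : emb (span (rcons ys Y)) G M f by apply: emb_weak fe => x [].
  have [_ _ fp] := fe.
  have /andP[_ cY] := cutv_mem x0 ch (a := 1) isT s0.
  have [f' [fe' _]] := attach_first ch s0 feM (proj2 (fp _ (span_mem_nth s0 cY))).
  by exists f'.
have hl : nth set0 (X :: rcons ys Y) (size (X :: rcons ys Y)).-1 = Y.
  by rewrite /= size_rcons /= nth_rcons ltnn eqxx.
have [||g ge] := emb_of_inl (D := span (rcons ys Y)) (f := f) (H := H) (k := #|X|.-1);
  last by case: (Hf _ ge).
  case: fe => fi fh fM; split=> //.
    by move=> u w uy wy; apply: fi; rewrite span_cons inE ?uy ?wy orbT.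
  by move=> u w uy wy; apply: fh; rewrite span_cons inE ?uy ?wy orbT.
move=> u p uy fu; have us : u \in span (X :: rcons ys Y) by rewrite span_cons inE uy orbT.
have s1 : 1 < size (X :: rcons ys Y) by rewrite /= size_rcons.
have := @petal_image W H x0 (X :: rcons ys Y) f ch s1; rewrite hl.
move/(_ (ltnW XY) fe u p us fu) => [|[]]; last by rewrite /=; lia.
rewrite !inE => /andP[/negP uc uX]; apply: uc.
have : u \in X :&: span (rcons ys Y) by rewrite inE uX.
by rewrite (chain_head_cap ch) ?size_rcons // (cutvP x0 ch (a := 1)) // inE.
Qed.

(** With equal ends a petal may host either end block, so only the middle [ys] is sure to map into
    [H]. Conversely, both ends can be attached to [ys], the second one avoiding the first. *)
Lemma prune_both X ys Y : chain C (X :: rcons ys Y) -> 0 < size ys -> #|X| = #|Y| ->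
  has_universal (X :: rcons ys Y) -> has_universal ys.
Proof.
move=> ch s0 XY; have [Y2 _ _] : blk C Y.
  by apply: (chain_blk ch); rewrite inE mem_rcons mem_head orbT.
have [x0 _] : exists x0, x0 \in Y by apply/set0Pn; rewrite -card_gt0; lia.
have chr : chain C (Y :: rev ys).
  have := chain_rev (chain_drop 1 ch); rewrite /= drop0 rev_rcons.
  by [].
have chl : chain C (X :: ys).
  have := chain_take (size ys).+1 ch; rewrite /= -cats1 take_cat ltnn subnn /= cats0.
  by [].
have srev : 0 < size (rev ys) by rewrite size_rev.
set c := cutv x0 (X :: ys) 1; set d := cutv x0 (Y :: rev ys) 1.
have cap1 : X :&: span ys = [set c].
  by rewrite (chain_head_cap chl) //; apply: (cutvP x0 chl (a := 1)).
have cap2 : Y :&: span ys = [set d].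
  by rewrite -(span_rev ys) (chain_head_cap chr) //; apply: (cutvP x0 chr (a := 1)).
have /andP[_ dY] : (d \in Y) && (d \in span ys) by rewrite -in_setI cap2 inE.
have /andP[_ cY] : (c \in X) && (c \in span ys) by rewrite -in_setI cap1 inE.
have XYd : X :&: Y = set0.
  apply/eqP; rewrite -cards_eq0.
  have := chain_cap ch (a := 0) (b := (size ys).+1).
  rewrite /= size_rcons !ltnS leqnn nth_rcons ltnn eqxx => -> //.
  by case: (size ys) s0.
have spanE : span (X :: rcons ys Y) = (span (X :: ys)) :|: Y.
  by rewrite -cats1 -cat_cons span_cat; congr (_ :|: _); apply/setP=> u; rewrite !inE /= orbF.
apply: (@prune _ _ #|X|.-1) => [V G M f fe|W H Hf f fe].
  have feM : emb (span ys) G M f by apply: emb_weak fe => x [].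
  have [_ _ fp] := fe.
  have [f' [fe' E]] := attach_first chl s0 feM (proj2 (fp _ cY)).
  have [|||f'' [fe'' _]] := attach_petal (X := Y) (c := d) fe'.
  - by rewrite span_cons setIUr (setIC Y X) XYd set0U.
  - move=> u w; rewrite -spanE => us ws uw.
    have [Z [Zs uZ wZ]] := chain_edge ch us ws uw.
    have [ZX|] : Z \in X :: ys \/ Z = Y.
      move: Zs; rewrite inE mem_rcons inE => /or3P[/eqP->|/eqP->|Zy].
      by left; rewrite mem_head.
        by right.
      by left; rewrite inE Zy orbT.
      by rewrite !(mem_span ZX).
    by move=> EZ; rewrite -EZ uZ wZ orbT.
  - by rewrite E // -XY; case: (fp _ dY).
  by exists f''; rewrite spanE.
have hl : nth set0 (X :: rcons ys Y) (size (X :: rcons ys Y)).-1 = Y.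
  by rewrite /= size_rcons /= nth_rcons ltnn eqxx.
have ysub u : u \in span ys -> u \in span (X :: rcons ys Y).
  by move=> uy; rewrite spanE span_cons !in_setU uy orbT.
have [||g ge] := emb_of_inl (D := span ys) (f := f) (H := H) (k := #|X|.-1);
  last by case: (Hf _ ge).
  case: fe => fi fh fM; split=> //.
    by move=> u w /ysub uy /ysub wy; apply: fi.
  by move=> u w /ysub uy /ysub wy; apply: fh.
move=> u p uy fu; have s1 : 1 < size (X :: rcons ys Y) by rewrite /= size_rcons.
have := @petal_image W H x0 (X :: rcons ys Y) f ch s1; rewrite hl.
move/(_ (eq_leq XY) fe u p (ysub u uy) fu) => [|[_]].
  rewrite !inE => /andP[/negP uc uX]; apply: uc.
  have : u \in X :&: span ys by rewrite inE uX.
  by rewrite cap1 inE /c /cutv /= nth_rcons s0.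
rewrite /= size_rcons !inE => /andP[/negP uc uY]; apply: uc.
have Em : nth set0 (X :: rcons ys Y) (size ys) = nth set0 ys (size ys).-1.
  by rewrite -{1}(prednK s0) /= nth_rcons prednK // leqnn.
have : u \in nth set0 (X :: rcons ys Y) (size ys) :&: Y.
  have : u \in Y :&: span ys by rewrite inE uY.
  rewrite cap2 inE => /eqP ud; rewrite inE uY andbT ud Em -subn1 -(nth_rev _ s0).
  by have /andP[] := cutv_mem x0 chr (a := 1) isT srev.
have sY : (size ys).+1 < size (X :: rcons ys Y) by rewrite /= size_rcons.
have := cutvP x0 ch (a := (size ys).+1) isT sY.
by rewrite -pred_Sn [nth _ _ (size ys).+1]/= nth_rcons ltnn eqxx => ->; rewrite inE.
Qed.

End Pruning.

(** * Hypergraphs of high girth *)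

Section Hypergraphs.

Implicit Types (es : seq (seq nat)) (e A : seq nat).

Definition nbrs es x := flatten [seq e <- es | x \in e].

Fixpoint ball es k x :=
  if k is k'.+1 then flatten (map (ball es k') (x :: nbrs es x)) else [:: x].

Definition deg es x := count (fun e => x \in e) es.

(* Hyperedges are listed latest first. *)
Fixpoint acyc L es :=
  if es is e :: es' then
    {in e &, forall x y, x != y -> y \notin ball es' L x} /\ acyc L es'
  else True.

Lemma nbrsP es x y :
  reflect (exists e, [/\ e \in es, x \in e & y \in e]) (y \in nbrs es x).
Proof.
apply: (iffP flattenP) => [[e]|[e [ees xe ye]]].
  by rewrite mem_filter => /andP[xe ees] ye; exists e.
by exists e; rewrite ?mem_filter ?xe.
Qed.

Lemma nbrs_sym es x y : (y \in nbrs es x) = (x \in nbrs es y).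
Proof. by apply/nbrsP/nbrsP => -[e [h1 h2 h3]]; exists e. Qed.

Lemma ballS es k x y :
  reflect (exists2 z, z \in x :: nbrs es x & y \in ball es k z) (y \in ball es k.+1 x).
Proof.
apply: (iffP flattenP) => [[s /mapP[z zx ->] ys]|[z zx yz]]; first by exists z.
by exists (ball es k z) => //; apply: map_f.
Qed.

Lemma ball_refl es k x : x \in ball es k x.
Proof.
by elim: k => [|k IH]; [rewrite inE|apply/ballS; exists x; rewrite ?mem_head].
Qed.

Lemma ball_cat es j k x y z : y \in ball es j x -> z \in ball es k y ->
  z \in ball es (j + k) x.
Proof.
elim: j x => [|j IH] x; first by rewrite inE => /eqP->.
by case/ballS=> w wx yw zy; rewrite addSn; apply/ballS; exists w; last exact: IH.
Qed.

Lemma ball_mono es j k x y : j <= k -> y \in ball es j x -> y \in ball es k x.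
Proof.
by move=> jk yx; rewrite -(subnKC jk); apply: ball_cat yx (ball_refl _ _ _).
Qed.

Lemma ball1 es x y : y \in x :: nbrs es x -> y \in ball es 1 x.
Proof. by move=> yx; apply/ballS; exists y; rewrite ?inE. Qed.

Lemma ball_sym es k x y : y \in ball es k x -> x \in ball es k y.
Proof.
elim: k x y => [|k IH] x y; first by rewrite !inE eq_sym.
case/ballS=> z zx /IH zy; rewrite -addn1; apply: ball_cat zy _; apply: ball1.
by move: zx; rewrite !inE nbrs_sym eq_sym.
Qed.

(** A walk that uses [e] would first have to reach a point of [e] by earlier hyperedges. *)
Lemma ball_cons_far e es k a b : (forall z, z \in e -> z \notin ball es k a) ->
  b \in ball (e :: es) k a -> b \in ball es k a.
Proof.
elim: k a => [|k IH] a far //.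
have ae : a \notin e by apply/negP=> /far; rewrite ball_refl.
case/ballS=> z; rewrite /nbrs /= (negPf ae) -/(nbrs es a) => za bz.
apply/ballS; exists z => //; apply: IH bz => w we.
by apply: contra (far w we) => wz; apply/ballS; exists z.
Qed.

Lemma size_flatten_le (T : Type) (s : seq (seq T)) c :
  (forall x, x \in map size s -> x <= c) -> size (flatten s) <= size s * c.
Proof.
elim: s => //= x s IH h; rewrite size_cat mulSn leq_add //.
  by apply: h; rewrite mem_head.
by apply: IH => y ys; apply: h; rewrite inE ys orbT.
Qed.

Lemma size_ball es m d k x : (forall e, e \in es -> size e <= m) ->
  (forall y, deg es y <= d) -> size (ball es k x) <= (d * m).+1 ^ k.
Proof.
move=> em ed; elim: k x => [|k IH] x //.
rewrite expnS; apply: leq_trans (size_flatten_le (c := (d * m).+1 ^ k) _) _.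
  by move=> y /mapP[s /mapP[z _ ->] ->].
rewrite size_map leq_mul2r /= ltnS; apply/orP; right.
apply: leq_trans (size_flatten_le (c := m) _) _.
  by move=> y /mapP[e]; rewrite mem_filter => /andP[_ /em em' ->].
by rewrite size_filter leq_mul2r ed orbT.
Qed.

Lemma sum_deg es b : (forall e, e \in es -> uniq e /\ all (fun x => x < b) e) ->
  \sum_(x <- iota 0 b) deg es x = \sum_(e <- es) size e.
Proof.
elim: es => [|e es IH] h; first by rewrite big_nil big1_seq.
rewrite big_cons -IH; last by move=> e' e'es; apply: h; rewrite inE e'es orbT.
rewrite /deg /= big_split /=; congr (_ + _).
have [eu /allP eb] := h e (mem_head _ _).
rewrite -big_mkcond /= sum1_count -size_filter.
apply/perm_size; apply: uniq_perm => // [|x]; first by rewrite filter_uniq ?iota_uniq.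
by rewrite mem_filter mem_iota /= add0n; case: (boolP (x \in e)) => // /eb ->.
Qed.

(** Greedy choice: by [q * c < size s], the lists near the points chosen so far never exhaust
    [s]. *)
Lemma far_subset (T : eqType) (near : T -> seq T) s c q :
  (forall x, size (near x) <= c) -> (forall x, x \in near x) ->
  (forall x y, y \in near x -> x \in near y) -> q * c < size s -> uniq s ->
  exists Y, [/\ size Y = q, uniq Y, {subset Y <= s}
              & {in Y &, forall x y, x != y -> y \notin near x}].
Proof.
move=> nc nr ns; elim: q => [|q IH] qs su; first by exists [::].
have [|Y [Yq Yu Ys Yf]] := IH _ su.
  by apply: leq_trans qs; rewrite ltnS mulSn leq_addl.
have [y ys yn] : exists2 y, y \in s & y \notin flatten (map near Y).
  apply: contrapT => ny.
  have : size s <= size (flatten (map near Y)).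
    apply: uniq_leq_size => // y ys; apply: contrapT => yn; apply: ny.
    by exists y => //; apply/negP.
  have := @size_flatten_le _ (map near Y) c.
  rewrite size_map Yq => h.
  have {}h : size (flatten (map near Y)) <= q * c.
    by apply: h => _ /mapP[_ /mapP[z _ ->] ->].
  by rewrite mulSn in qs; lia.
have yY z : z \in Y -> y \notin near z.
  by move=> zY; apply: contra yn => yz; apply/flattenP; exists (near z); rewrite ?map_f.
exists (y :: Y); split=> /=; first by rewrite Yq.
- by rewrite Yu andbT; apply/negP=> /yY; rewrite nr.
- by move=> x; rewrite inE => /orP[/eqP->|/Ys].
- move=> x z; rewrite !inE => /orP[/eqP->|xY] /orP[/eqP->|zY]; rewrite ?eqxx //.
  + by move=> _; apply: contra (yY _ zY) => /ns.
  + by move=> _; apply: yY.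
  + exact: Yf.
Qed.

Variables (m L q : nat).

(** After [t] steps there are [2 * t] hyperedges of size [m.+1], so by counting incidences at most
    [t / 2] vertices have degree [4 * m.+1] or more. *)
Definition max_deg := 4 * m.+1.
(** The power bounds the balls of radius [L]. The initial vertices alone outweigh [m + m + q] such
    balls, and each step adds more vertices of low degree than it can use up on average. *)
Definition num_roots := (2 * ((m + m + q) * (max_deg * m.+1).+1 ^ L)).+1.

(* After [t] steps the vertices are the numbers below [num_roots + t]. *)
Record stage t es : Prop := Stage {
  stage_edge : forall e, e \in es ->
    [/\ uniq e, size e = m.+1 & all (fun x => x < num_roots + t) e];
  stage_size : size es = 2 * t;
  stage_deg : forall x, deg es x <= max_deg;
  stage_acyc : acyc L es;
  stage_new : forall x, num_roots <= x -> x < num_roots + t ->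
    exists A, x :: A \in es /\ all (fun a => a < x) A }.

Lemma stage0 : stage 0 [::].
Proof. by split=> // x; rewrite addn0 ltnNge => ->. Qed.

Lemma stage_far t es : stage t es -> exists Y, [/\ size Y = m + m + q, uniq Y,
  forall x, x \in Y -> x < num_roots + t /\ deg es x < max_deg
  & {in Y &, forall x y, x != y -> y \notin ball es L x}].
Proof.
move=> st; set b := num_roots + t.
pose low := [seq x <- iota 0 b | deg es x < max_deg].
have hi : count (fun x => ~~ (deg es x < max_deg)) (iota 0 b) * max_deg <=
    \sum_(x <- iota 0 b) deg es x.
  elim: (iota 0 b) => [|x s IH] /=; first by rewrite big_nil.
  by rewrite big_cons mulnDl leq_add //; case: (ltnP (deg es x)); rewrite ?mul1n.
rewrite sum_deg in hi; last by move=> e /(stage_edge st)[].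
have E : \sum_(e <- es) size e = 2 * t * m.+1.
  rewrite -(stage_size st) big_seq (eq_bigr (fun=> m.+1)) => [|e /(stage_edge st)[]//].
  by rewrite -big_seq big_const_seq count_predT iter_addn_0 mulnC.
rewrite E [in X in _ * X]/max_deg mulnA leq_pmul2r // in hi.
have lowE : count (fun x => ~~ (deg es x < max_deg)) (iota 0 b) + size low = b.
  by rewrite size_filter addnC count_predC size_iota.
have {E}hi2 : 2 * count (fun x => ~~ (deg es x < max_deg)) (iota 0 b) <= t.
  by move: hi; lia.
have [|||||Y [Yq Yu Ys Yf]] := @far_subset _ (ball es L) low
    ((max_deg * m.+1).+1 ^ L) (m + m + q).
- move=> x; apply: size_ball; last exact: stage_deg st.
  by move=> e /(stage_edge st)[_ ->].
- exact: ball_refl.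
- by move=> x y; apply: ball_sym.
- by move: hi2 lowE; rewrite /b /num_roots; lia.
- by rewrite filter_uniq ?iota_uniq.
exists Y; split=> // x /Ys; rewrite mem_filter mem_iota add0n.
by case/andP=> h1 /andP[_ h2].
Qed.

(** The far points are cut into [A], [A'] and [js]; as these are disjoint, an old vertex gains
    degree at most one. The choice of [j] stays open: it is the freedom by which [alive_step]
    excludes values. *)
Lemma stage_step t es : stage t es -> exists A A' js,
  [/\ size A = m, uniq (num_roots + t :: A) & all (fun a => a < num_roots + t) A] /\
  [/\ size A' = m, size js = q, uniq js
   & forall j, j \in js -> [/\ uniq (j :: A'),
       all (fun a => a < num_roots + t) (j :: A')
     & stage t.+1 ((j :: A') :: (num_roots + t :: A) :: es)]].
Proof.
move=> st; have [Y [Yq Yu Yl Yf]] := stage_far st.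
set b := num_roots + t in Yl *.
pose A := take m Y; pose A' := take m (drop m Y); pose js := drop m (drop m Y).
have YE : Y = A ++ A' ++ js by rewrite !cat_take_drop.
have sA : size A = m by rewrite size_take_min Yq; lia.
have sA' : size A' = m by rewrite size_take_min size_drop Yq; lia.
have sj : size js = q by rewrite !size_drop Yq; lia.
have AY x : x \in A -> x \in Y by rewrite YE mem_cat => ->.
have A'Y x : x \in A' -> x \in Y by rewrite YE !mem_cat => ->; rewrite orbT.
have jY x : x \in js -> x \in Y by rewrite YE !mem_cat => ->; rewrite !orbT.
move: Yu; rewrite YE !cat_uniq => /and3P[Au nA /and3P[A'u nA' ju]].
have Ajs x y : x \in A -> y \in A' ++ js -> x != y.
  by move=> xA yA; apply: contraNneq nA => E; apply/hasP; exists y; rewrite // -E.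
have A'js x y : x \in A' -> y \in js -> x != y.
  by move=> xA yA; apply: contraNneq nA' => E; apply/hasP; exists y; rewrite // -E.
have bY : b \notin Y by apply/negP=> /Yl[]; rewrite ltnn.
have bu : uniq (b :: A) by rewrite /= Au andbT; apply: contra bY => /AY.
have bes e : e \in es -> b \notin e.
  by move=> /(stage_edge st)[_ _ /allP h]; apply/negP=> /h; rewrite ltnn.
(* The new vertex [b] lies in no earlier hyperedge, so no ball of [es] around another vertex
   contains it. *)
have bball k x : x != b -> b \notin ball es k x.
  elim: k x => [|k IH] x xb; first by rewrite inE eq_sym.
  apply/negP=> /ballS[z]; rewrite inE => /orP[/eqP->|/nbrsP[e [ees _ ze]]].
    by rewrite (negPf (IH x xb)).
  have zb : z != b by apply: contraNneq (bes e ees) => <-.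
  by rewrite (negPf (IH z zb)).
exists A, A', js; split; split=> //.
  by apply/allP=> a /AY /Yl[].
move=> j jj; have ju' : uniq (j :: A').
  by rewrite /= A'u andbT; apply/negP=> /A'js /(_ jj); rewrite eqxx.
have jAY x : x \in j :: A' -> x \in Y by rewrite inE => /orP[/eqP->|]; [exact: jY|exact: A'Y].
have jAjs x : x \in j :: A' -> x \in A' ++ js.
  by rewrite inE mem_cat => /orP[/eqP->|->//]; rewrite jj orbT.
have jal : all (fun a => a < b) (j :: A') by apply/allP=> a /jAY /Yl[].
split=> //; split.
- move=> e; rewrite !inE addnS => /or3P[/eqP->|/eqP->|/(stage_edge st)[h1 h2 /allP h3]].
  + split=> //; first by rewrite /= sA'.
    by apply/allP=> a /(allP jal) h; rewrite ltnS ltnW.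
  + split=> //; first by rewrite /= sA.
    by apply/allP=> a; rewrite inE ltnS => /orP[/eqP->|/AY /Yl[/ltnW]].
  + by split=> //; apply/allP=> a /h3 h; rewrite ltnS ltnW.
- by rewrite /= (stage_size st) mulnS.
- move=> x; rewrite /deg /= -/(deg es x); have dx := stage_deg st x.
  case: (boolP (x \in j :: A')) => [xj|_] /=.
    have [xl xd] := Yl x (jAY x xj).
    have -> : x \in b :: A = false; last exact: xd.
    apply/negP; rewrite inE => /orP[/eqP xb|xA].
      by move: xl; rewrite xb ltnn.
    by have := Ajs x x xA (jAjs x xj); rewrite eqxx.
  case: (boolP (x \in b :: A)) => [|_] //; rewrite inE => /orP[/eqP->|/AY /Yl[_]]; last by [].
  have -> : deg es b = 0; last by rewrite /max_deg.
  by apply/eqP; rewrite -leqn0 leqNgt -has_count; apply/hasPn.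
- split; last split; last exact: stage_acyc st.
  (* The points of [j :: A'] are also far from [b] and from [A], so the hyperedge just added creates
     no short way between them. *)
  + move=> x y xj yj xy; apply/negP=> /ball_cons_far h.
    have : y \in ball es L x; last by apply/negP; apply: Yf => //; apply: jAY.
    apply: h => z; rewrite inE => /orP[/eqP->|zA].
      apply: bball; apply: contraNneq bY => <-; exact: jAY.
    apply: Yf; [exact: jAY|exact: AY|].
    by rewrite eq_sym; apply: Ajs => //; apply: jAjs.
  + move=> x y; rewrite !inE => /orP[/eqP->|xA] /orP[/eqP->|yA]; rewrite ?eqxx //.
    * move=> yb; apply/negP=> /ball_sym; apply/negP; apply: bball.
      by rewrite eq_sym.
    * by move=> xb; apply: bball.
    * by apply: Yf; apply: AY.
- move=> x xr; rewrite addnS ltnS leq_eqVlt => /orP[/eqP->|xb].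
    exists A; rewrite !inE eqxx orbT; split=> //.
    by apply/allP=> a /AY /Yl[].
  have [B [Bes Bl]] := stage_new st xr xb.
  by exists B; rewrite !inE Bes !orbT.
Qed.

End Hypergraphs.

(** * Cliques with attached tails *)

Section TailGraph.

Variables (T : finType) (C : sgraph T).
Implicit Types (X Y D : {set T}) (xs ys : seq {set T}) (es : seq (seq nat)).

Definition core_rel es : rel nat :=
  fun x y => (x != y) && has (fun e => (x \in e) && (y \in e)) es.

Lemma core_sym es : symmetric (core_rel es).
Proof.
move=> x y; rewrite /core_rel eq_sym; congr (_ && _).
by apply: eq_has => e; rewrite andbC.
Qed.

Lemma core_irr es : irreflexive (core_rel es).
Proof. by move=> x; rewrite /core_rel eqxx. Qed.

Definition core es := SGraph (@core_sym es) (@core_irr es).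

(** [(x, u)] is the copy of [u] in the fibre over [x], and the roots [(x, r)] carry the core.
    Working with all of [T] avoids a subtype; the copies of vertices outside [D] other than [r] are
    isolated. *)
Definition tail_rel D r (K : rel nat) : rel (nat * T) := fun p q =>
  [&& p.1 == q.1, p.2 \in D, q.2 \in D & C p.2 q.2]
  || [&& p.2 == r, q.2 == r & K p.1 q.1].

Lemma tail_sym D r (K : sgraph nat) : symmetric (tail_rel D r K).
Proof.
move=> p q; rewrite /tail_rel eq_sym (adj_sym C) (adj_sym K) andbCA !andbA.
congr (_ || _); last by rewrite [X in X && _]andbC.
by rewrite -!andbA [in LHS]andbCA; congr (_ && _); rewrite andbCA.
Qed.

Lemma tail_irr D r (K : sgraph nat) : irreflexive (tail_rel D r K).
Proof. by move=> p; rewrite /tail_rel !adj_irr !andbF. Qed.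

Definition tail_graph D r K := SGraph (@tail_sym D r K) (@tail_irr D r K).

(** On a path from [v] stopped at its first point in [e], every edge starts outside [e] and so comes
    from [es]. The radius [#|T|] bounds the length of a simple path. *)
Lemma first_hit es e f Y v b : conn C Y ->
  {in Y &, forall u w, C u w -> core (e :: es) (f u) (f w)} ->
  v \in Y -> b \in Y -> f v \notin e -> f b \in e ->
  exists c, [/\ c \in Y, f c \in e & f c \in ball es #|T| (f v)].
Proof.
move=> cY fh vY bY fv fb.
pose R u w := [&& C u w, u \in Y, w \in Y & f u \notin e].
have [c [cYc fc vc]] : exists c, [/\ c \in Y, f c \in e & connect R v c].
  apply: contrapT => nc; suff vb : connect R v b by apply: nc; exists b.
  apply: (cY (connect R v) v b) => // u w uY wY uw vu.
  have fu : f u \notin e by apply/negP=> fu; apply: nc; exists u.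
  by apply: connect_trans vu _; apply: connect1; rewrite /R uw uY wY fu.
exists c; split=> //; case/connectP: vc => p /shortenP[p' Rp' up' _ ->].
have sp : size p' <= #|T|.
  by apply: ltnW; have := max_card (mem (v :: p')); rewrite (card_uniqP up').
apply: ball_mono sp _; elim: p' v {vY fv fc up'} Rp' => [|w p' IH] v.
  by rewrite /= inE.
case/andP=> /and4P[vw vY wY fv] /IH h; rewrite [last _ _]/= [size _]/= -add1n.
apply: ball_cat h; apply: ball1; rewrite inE; apply/orP; right; apply/nbrsP.
have /andP[_ /=] := fh v w vY wY vw; rewrite (negPf fv) /=.
by case/hasP=> e' e'es /andP[h1 h2]; exists e'.
Qed.

(* If a block leaves the latest hyperedge [e] and has two vertices in it, then
   removing one of them yields two short earlier paths from the outside vertex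
   to distinct points of [e], against the girth condition. *)
Lemma core_block L es f X : 2 * #|T| <= L -> acyc L es -> blk C X ->
  {in X &, injective f} -> {in X &, forall u w, C u w -> core es (f u) (f w)} ->
  exists2 e, e \in es & forall u, u \in X -> f u \in e.
Proof.
move=> LT; elim: es => [|e es IH] ac bX fi fh.
  have [X2 cX _] := bX.
  have /card_gt0P[u uX] : 0 < #|X| by lia.
  have [w wX /(fh _ _ uX wX)] := conn_nbr cX X2 uX.
  by rewrite /= /core_rel andbF.
have [all_e|] := pselect (forall u, u \in X -> f u \in e).
  by exists e; rewrite ?mem_head.
move/existsNP=> [v /not_implyP[vX /negP fv]].
case: ac => far ac.
have one a b : a \in X -> b \in X -> f a \in e -> f b \in e -> a = b.
  move=> aX bX' fa fb; apply: contrapT => ab; have [_ cX cXd] := bX.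
  have [c [cX' fc vc]] := first_hit cX fh vX aX fv fa.
  have [d [dX dc fd]] : exists d, [/\ d \in X, d != c & f d \in e].
    have [E|ac'] := eqVneq a c; last by exists a.
    by exists b; split=> //; rewrite -E eq_sym; apply/eqP.
  have fh' : {in X :\ c &, forall u w, C u w -> core (e :: es) (f u) (f w)}.
    by move=> u w /setD1P[_ uX] /setD1P[_ wX]; apply: fh.
  have [||c' []] := first_hit (cXd c) fh' (v := v) (b := d) _ _ fv fd.
  - by rewrite !inE vX andbT; apply: contraNneq fv => ->.
  - by rewrite !inE dc.
  rewrite !inE => /andP[cc' c'X] fc' vc'.
  have fcc' : f c != f c' by apply: contra cc' => /eqP /fi ->.
  have /negP := far _ _ fc fc' fcc'; apply; apply: ball_mono LT _.
  by rewrite mul2n -addnn; apply: ball_cat (ball_sym vc) vc'.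
(* Since [e] holds at most one vertex of the image, it accounts for no edge of the block, and the
   induction applies to [es]. *)
have [|e' e'es h] := IH ac bX fi; last by exists e'; rewrite // inE e'es orbT.
move=> u w uX wX uw; have /andP[fuw /=] := fh u w uX wX uw.
case/orP=> [/andP[fu fw]|h]; last by rewrite /core_rel fuw.
by move: uw; rewrite (one u w) // adj_irr.
Qed.

Lemma span_drop_take ys k u : chain C ys -> 0 < k -> k < size ys ->
  u \in span (take k.+1 ys) -> u \in span (drop 1 ys) ->
  u \in span (drop 1 (take k.+1 ys)).
Proof.
move=> ch k0 sk /spanP[a]; rewrite size_take_min leq_min => /andP[ak sa].
rewrite nth_take // => ua /spanP[b]; rewrite size_drop nth_drop => sb ub.
apply/spanP; case: a => [|a] in ak sa ua *.
  have sb' : 1 + b < size ys by lia.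
  have Eb := chain_adj ch (isT : 0 < 1 + b) sb' ua ub.
  exists 0; first by rewrite size_drop size_take_min; lia.
  by rewrite nth_drop nth_take // addn0 -Eb.
exists a; first by rewrite size_drop size_take_min; lia.
by rewrite nth_drop nth_take.
Qed.

Lemma span_drop_nth ys k b u : k <= b -> b < size ys -> u \in nth set0 ys b ->
  u \in span (drop k ys).
Proof.
move=> kb sb ub; apply/spanP; exists (b - k); first by rewrite size_drop; lia.
by rewrite nth_drop subnKC.
Qed.

Lemma span_take_nth ys k b u : b < k -> b < size ys -> u \in nth set0 ys b ->
  u \in span (take k ys).
Proof.
move=> kb sb ub; apply/spanP; exists b; first by rewrite size_take_min leq_min kb.
by rewrite nth_take.
Qed.

Lemma span_dropS ys j k u : j <= k -> u \in span (drop k ys) -> u \in span (drop j ys).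
Proof.
move=> jk /spanP[b]; rewrite size_drop nth_drop => sb.
by apply: span_drop_nth; lia.
Qed.

Variables (xs : seq {set T}) (r : T).
Hypothesis ch : chain C xs.
Hypothesis r0 : r \in nth set0 xs 0.
Hypothesis r1 : 1 < size xs -> r = cutv r xs 1.

Let D0 := span (drop 1 xs).
Let n := #|nth set0 xs 0|.

Lemma size_xs_gt0 : 0 < size xs.
Proof. by case: (xs) r0 => //=; rewrite inE. Qed.

Lemma root_cap u : u \in nth set0 xs 0 -> u \in D0 -> u = r.
Proof.
rewrite /D0 => u0; have [s1|s1] := ltnP 1 (size xs); last by rewrite drop_oversize ?inE.
move=> uD; have : u \in span (take 1 xs) :&: span (drop 1 xs).
  by rewrite inE (take1_span size_xs_gt0) u0.
by rewrite (take_drop_cap r ch) // inE -r1 // => /eqP.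
Qed.

Lemma root_tail : 1 < size xs -> r \in D0.
Proof.
move=> s1; have : r \in span (take 1 xs) :&: span (drop 1 xs).
  by rewrite (take_drop_cap r ch) // inE -r1.
by rewrite inE => /andP[].
Qed.

(* The first block [X] of the path does not fit into a core clique, so it lies
   in a fibre; the fibre meets the rest in its root only, so the image of some
   head of the path lies in that fibre. If the head reaches level [k] of the
   tail, then the cut vertices of levels [1..k] are images of cut vertices of
   the head. Comparing sizes, the block after the head is at least as large as
   [X], yet it must lie in a core clique. *)
Lemma tail_graph_free L es : 2 * #|T| <= L -> acyc L es ->
  (forall e, e \in es -> size e < n) ->
  free_of C (span xs) (tail_graph D0 r (core es)) (fun=> True).
Proof.
move=> LT ac esn f [fi fh _]; set S := span xs in fi fh.
have s0 := size_xs_gt0.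
have nthS a u : a < size xs -> u \in nth set0 xs a -> u \in S by apply: span_mem_nth.
have [X02 _ X0d] := chain_blk ch (mem_nth set0 s0).
have cS : conn C S by apply: conn_span ch.
have S2 : 1 < #|S|.
  by apply: leq_trans X02 (subset_leq_card _); apply/subsetP=> u; apply: nthS.
have D0S : {subset D0 <= S}.
  by move=> u uD; rewrite /S (span_take_drop 1) in_setU; apply/orP; right.
have edge u w : u \in S -> w \in S -> C u w ->
    [/\ (f u).1 = (f w).1, (f u).2 \in D0, (f w).2 \in D0 & C (f u).2 (f w).2] \/
    [/\ (f u).2 = r, (f w).2 = r & core es (f u).1 (f w).1].
  move=> uS wS uw; case/orP: (fh u w uS wS uw).
    by case/and4P=> /eqP h1 h2 h3 h4; left.
  by case/and3P=> /eqP h1 /eqP h2 h3; right.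
have fS u : u \in S -> (f u).2 \in r |: D0.
  move=> uS; have [w wS uw] := conn_nbr cS S2 uS; rewrite in_setU1.
  by case: (edge u w uS wS uw) => [[_ h _ _]|[-> _ _]]; rewrite ?eqxx ?h ?orbT.
have fib Y x v w : {subset Y <= S} -> conn C Y ->
    (forall u, u \in Y -> f u <> (x, r)) -> v \in Y -> (f v).1 = x -> w \in Y ->
    (f w).1 = x.
  move=> YS cY nr vY fv wY; apply: (cY (fun u => (f u).1 = x) v w) => //.
  move=> a b aY bY ab fa; case: (edge a b (YS a aY) (YS b bY) ab) => [[<-]//|[fa2 _ _]].
  by case: (nr a aY); rewrite -fa -fa2 -surjective_pairing.
(* A vertex sent off the core confines its block to one fibre: the only exit is the root, and
   deleting its preimage leaves the block connected. *)
have dich X : {subset X <= S} -> blk C X ->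
    (exists x, forall u, u \in X -> (f u).1 = x) \/ (forall u, u \in X -> (f u).2 = r).
  move=> XS [_ cX cXd]; have [allr|] := pselect (forall u, u \in X -> (f u).2 = r).
    by right.
  move/existsNP=> [v /not_implyP[vX fv]]; left; exists (f v).1 => w wX.
  have [[c [cX' fc]]|nc] := pselect (exists c, c \in X /\ f c = ((f v).1, r)).
    have [->|wc] := eqVneq w c; first by rewrite fc.
    apply: (fib (X :\ c) _ v w) => //.
    - by move=> u /setD1P[_ /XS].
    - move=> u /setD1P[uc uX] fu; case/eqP: uc; apply: fi; [exact: XS|exact: XS|].
      by rewrite fu fc.
    - by rewrite !inE vX andbT; apply: contra_notN fv => /eqP->; rewrite fc.
    - by rewrite !inE wc.
  by apply: (fib X _ v w) => // u uX fu; apply: nc; exists u.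
have small X : {subset X <= S} -> blk C X -> (forall u, u \in X -> (f u).2 = r) ->
    #|X| < n.
  move=> XS bX Xr; have f1i : {in X &, injective (fun u => (f u).1)}.
    move=> u w uX wX E; apply: fi; [exact: XS|exact: XS|].
    by rewrite [f u]surjective_pairing E !Xr // -(Xr w wX) -surjective_pairing.
  have [|e ees he] := core_block LT ac bX f1i.
    move=> u w uX wX uw; case: (edge u w (XS u uX) (XS w wX) uw) => [[_ _ _]|[_ _]//].
    by rewrite !Xr // adj_irr.
  apply: leq_ltn_trans (esn e ees); rewrite cardE -(size_map (fun u => (f u).1)).
  apply: uniq_leq_size => [|x /mapP[u]].
    rewrite map_inj_in_uniq ?enum_uniq // => u w; rewrite !mem_enum; exact: f1i.
  by rewrite mem_enum => uX ->; apply: he.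
have X0S : {subset nth set0 xs 0 <= S} by move=> u; apply: nthS.
have [[x fX0]|X0r] := dich _ X0S (chain_blk ch (mem_nth set0 s0)); last first.
  by have := small _ X0S (chain_blk ch (mem_nth set0 s0)) X0r; rewrite /n ltnn.
have other c : exists2 a, a \in nth set0 xs 0 & a != c.
  have : 0 < #|nth set0 xs 0 :\ c|.
    rewrite -ltnS; apply: leq_trans X02 _.
    by rewrite (cardsD1 c) -[leqRHS]add1n leq_add2r leq_b1.
  by case/card_gt0P=> a /setD1P[ac' aX]; exists a.
(* The useful part of a fibre has fewer vertices than the span, so the image leaves the fibre over
   [x]. *)
have [u uS fu] : exists2 u, u \in S & (f u).1 <> x.
  apply: contrapT => nu; have fx u : u \in S -> (f u).1 = x.
    by move=> uS; apply: contrapT => fu; apply: nu; exists u.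
  have le : #|S| <= #|r |: D0|.
    rewrite -(card_in_imset (f := fun u => (f u).2) (D := S)).
      by apply/subset_leq_card/subsetP=> _ /imsetP[u uS ->]; apply: fS.
    move=> u w uS wS E; apply: fi => //.
    by rewrite [f u]surjective_pairing [f w]surjective_pairing E !fx.
  have : #|r |: D0| < #|S|; last by rewrite ltnNge le.
  apply/proper_card/properP; split.
    by apply/subsetP=> u /setU1P[->|/D0S//]; apply: X0S.
  have [a aX ar] := other r; exists a; first exact: X0S.
  rewrite in_setU1 (negPf ar) /=; apply/negP=> aD; case/eqP: ar.
  exact: root_cap.
have [c0 c0S fc0] : exists2 c, c \in S & f c = (x, r).
  apply: contrapT => nc; have [a aX _] := other r.
  apply: fu; apply: (fib S x a u) => //; [|exact: X0S|exact: fX0].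
  by move=> w wS fw; apply: nc; exists w.
have c0u w : w \in S -> f w = (x, r) -> w = c0.
  by move=> wS fw; apply: fi; rewrite // fw.
have uc0 : u != c0 by apply: contra_notN fu => /eqP->; rewrite fc0.
have [a0 a0X a0c] := other c0.
have [i [i0 si Ei]] : exists i, [/\ 0 < i, i < size xs & cutv r xs i = c0].
  apply: contrapT => ni; have cSc : conn C (S :\ c0).
    by apply: (@conn_spanD1 _ C r) => // a h1 h2; apply/eqP=> E; apply: ni; exists a.
  apply: fu; apply: (fib (S :\ c0) x a0 u) => //.
  - by move=> w /setD1P[].
  - by move=> w /setD1P[wc wS] /(c0u _ wS) E; case/eqP: wc.
  - by rewrite in_setD1 a0c; apply: X0S.
  - exact: fX0.
  - by rewrite in_setD1 uc0.
have s1 : 1 < size xs by lia.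
have rE := r1 s1.
set Hd := span (take i xs); set Tl := span (drop i xs).
have HdS : {subset Hd <= S} by move=> w wH; rewrite /S (span_take_drop i) in_setU -/Hd wH.
have TlS : {subset Tl <= S}.
  by move=> w wT; rewrite /S (span_take_drop i) in_setU -/Tl wT orbT.
have SHT w : w \in S -> w \in Hd \/ w \in Tl.
  by rewrite /S (span_take_drop i) in_setU => /orP.
have HTc w : w \in Hd -> w \in Tl -> w = c0.
  move=> wH wT; have : w \in Hd :&: Tl by rewrite in_setI wH.
  by rewrite (take_drop_cap r ch) // Ei inE => /eqP.
have /andP[c0H c0T] : (c0 \in Hd) && (c0 \in Tl).
  by rewrite -in_setI (take_drop_cap r ch) // Ei inE.
have X0H w : w \in nth set0 xs 0 -> w \in Hd.
  by move=> wX; apply/spanP; exists 0; rewrite ?nth_take ?size_take ?si.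
have cH : conn C (Hd :\ c0) by rewrite -Ei; apply: conn_head.
have cT : conn C (Tl :\ c0) by rewrite -Ei; apply: conn_tail.
have fH w : w \in Hd -> (f w).1 = x.
  move=> wH; have [->|wc] := eqVneq w c0; first by rewrite fc0.
  apply: (fib (Hd :\ c0) x a0 w) => //.
  - by move=> v /setD1P[_ /HdS].
  - by move=> v /setD1P[vc /HdS vS] /(c0u _ vS) E; case/eqP: vc.
  - by rewrite in_setD1 a0c X0H.
  - exact: fX0.
  - by rewrite in_setD1 wc.
have uT : u \in Tl by case: (SHT u uS) => // /fH.
have fT w : w \in Tl -> w != c0 -> (f w).1 <> x.
  move=> wT wc fw; apply: fu; apply: (fib (Tl :\ c0) x w u) => //.
  - by move=> v /setD1P[_ /TlS].
  - by move=> v /setD1P[vc /TlS vS] /(c0u _ vS) E; case/eqP: vc.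
  - by rewrite in_setD1 wc.
  - by rewrite in_setD1 uc0.
(* Deep means strictly beyond the [k]-th cut vertex. The largest reached level confines the tail
   coordinates of the head to the blocks [1] to [k]. *)
pose deep k c := (c \in span (drop k xs)) && (c != cutv r xs k).
pose reached k := [&& 0 < k, k < size xs & [exists c in Hd, deep k (f c).2]].
have ex_k : exists k, reached k.
  exists 1; rewrite /reached s1 /=; apply/existsP; exists a0.
  rewrite X0H //= /deep -rE; have := fS a0 (X0S _ a0X); rewrite in_setU1.
  have fa0 : (f a0).2 != r.
    apply: contra a0c => /eqP E; apply/eqP/c0u; first exact: X0S.
    by rewrite [f a0]surjective_pairing E fX0.
  by rewrite (negPf fa0) /= => ->.
have le_k k : reached k -> k <= size xs by case/and3P=> _ /ltnW.
case: (ex_maxnP ex_k le_k) => k /and3P[k0 sk /existsP[g /andP[gH gk]]] kmax.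
have f2S w : w \in S -> (f w).2 \in S.
  by move/fS/setU1P=> [->|/D0S//]; apply: X0S.
have HdK c : c \in Hd -> (f c).2 \in span (drop 1 (take k.+1 xs)).
  move=> cH'; apply: (span_drop_take ch k0 sk); last first.
    by have := fS c (HdS c cH'); rewrite in_setU1 => /orP[/eqP->|//]; apply: root_tail.
  have [sk1|sk1] := ltnP k.+1 (size xs); last first.
    by rewrite take_oversize //; apply: f2S; apply: HdS.
  apply: contrapT => nt; have := f2S c (HdS c cH').
  rewrite /S (span_take_drop k.+1) in_setU => /orP[//|fd].
  have : reached k.+1; last by move/kmax; rewrite ltnn.
  rewrite /reached sk1 /=; apply/existsP; exists c; rewrite cH' /deep fd /=.
  apply: contra_notN nt => /eqP E; have : (f c).2 \in [set cutv r xs k.+1] by rewrite inE E.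
  by rewrite -(take_drop_cap r ch) // inE => /andP[].
(* Inside the fibre, the way out from beyond [cutv r xs t] passes through that vertex; its preimage
   therefore separates [g] from [u] and is a cut vertex of [C]. *)
have hit t : 0 < t -> t <= k -> exists a, [/\ 0 < a, a <= i
    & (f (cutv r xs a)).2 = cutv r xs t].
  move=> t0 tk; have st : t < size xs by apply: leq_ltn_trans sk.
  pose Z c := (f c).1 = x /\ deep t (f c).2.
  have Zg : Z g.
    split; first exact: fH.
    case/andP: gk => gd gc; rewrite /deep; have [Et|tk'] := eqVneq t k; first by rewrite Et gd.
    have tk2 : t < k by rewrite ltn_neqAle tk'.
    apply/andP; split; last first.
      by apply: contraTneq gd => ->; apply: (cutv_notin_drop r ch).
    exact: span_dropS tk gd.
  have gS := HdS g gH.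
  have tcap v : v \in span (take t xs) -> v \in span (drop t xs) -> v = cutv r xs t.
    move=> v1 v2; have : v \in span (take t xs) :&: span (drop t xs) by rewrite in_setI v1.
    by rewrite (take_drop_cap r ch) // inE => /eqP.
  have closed Y : {subset Y <= S} -> conn C Y -> g \in Y -> u \in Y ->
      exists c, c \in Y /\ f c = (x, cutv r xs t).
    move=> YS cY gY uY; apply: contrapT => nc; apply: fu.
    suff [] : Z u by [].
    apply: (cY Z g u) => // a b aY bY ab [fa /andP[fad fac]].
    case: (edge a b (YS a aY) (YS b bY) ab) => [[E _ fbD Cab]|[far _ _]].
      split; first by rewrite -E.
      have [j [sj aj bj]] := chain_edge_nth ch (f2S a (YS a aY)) (D0S _ fbD) Cab.
      have tj : t <= j.
        rewrite leqNgt; apply/negP=> jt; case/eqP: fac; apply: tcap => //.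
        exact: span_take_nth jt sj aj.
      apply/andP; split; first exact: span_drop_nth tj sj bj.
      apply/eqP=> fb; apply: nc; exists b; split=> //.
      by rewrite [f b]surjective_pairing fb -E fa.
    case/eqP: fac; apply: tcap => //; rewrite far.
    exact: span_take_nth t0 s0 r0.
  have [c [cS' fc]] := closed S (fun _ h => h) cS gS uS.
  have [a [h1 h2 Ea]] : exists a, [/\ 0 < a, a < size xs & cutv r xs a = c].
    apply: contrapT => na; have cSc : conn C (S :\ c).
      by apply: (@conn_spanD1 _ C r) => // a h1 h2; apply/eqP=> E; apply: na; exists a.
    have [|||d [/setD1P[dc dS] fd]] := closed _ _ cSc.
    - by move=> v /setD1P[].
    - rewrite in_setD1 gS andbT; apply: contraTneq Zg.2 => ->.
      by rewrite fc /deep eqxx andbF.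
    - by rewrite in_setD1 uS andbT; apply: contra_notN fu => /eqP->; rewrite fc.
    by case/eqP: dc; apply: fi; rewrite // fd fc.
  exists a; split=> //; last by rewrite Ea fc.
  apply: (cutv_take_mem (x0 := r) ch i0 si h1 h2); rewrite Ea.
  case: (SHT c cS') => // cTl; have [->//|cc0] := eqVneq c c0.
  by case: (fT c cTl cc0); rewrite fc.
have ki : k <= i.
  have := @uniq_leq_size _ (map (cutv r xs) (iota 1 k))
     (map (fun a => (f (cutv r xs a)).2) (iota 1 i)).
  rewrite !size_map !size_iota; apply.
    rewrite map_inj_in_uniq ?iota_uniq // => a b; rewrite !mem_iota !add1n !ltnS.
    case/andP=> a1 a2 /andP[b1 b2]; apply: (cutv_inj ch) => //.
      exact: leq_ltn_trans a2 sk.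
    exact: leq_ltn_trans b2 sk.
  move=> v /mapP[t]; rewrite mem_iota add1n ltnS => /andP[t1 t2] ->.
  have [a [h1 h2 <-]] := hit t t1 t2.
  by apply: (map_f (fun a => (f (cutv r xs a)).2)); rewrite mem_iota add1n ltnS h1.
have cHd : #|Hd| = (excess (take i xs)).+1.
  by apply: (card_span (chain_take i ch)); case: (xs) i0 s0; case: (i).
have sdk : 0 < size (drop 1 (take k.+1 xs)).
  by rewrite size_drop size_take_min subn_gt0 leq_min ltnS k0.
have cK : #|span (drop 1 (take k.+1 xs))| = (excess (drop 1 (take k.+1 xs))).+1.
  apply: (card_span (chain_drop 1 (chain_take k.+1 ch))).
  by rewrite -size_eq0 -lt0n.
have leHK : #|Hd| <= #|span (drop 1 (take k.+1 xs))|.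
  rewrite -(card_in_imset (f := fun u => (f u).2) (D := Hd)).
    by apply/subset_leq_card/subsetP=> _ /imsetP[w wH ->]; apply: HdK.
  move=> v w vH wH E; apply: fi; [exact: HdS|exact: HdS|].
  by rewrite [f v]surjective_pairing [f w]surjective_pairing E !fH.
have exK : excess (take k.+1 xs) = n.-1 + excess (drop 1 (take k.+1 xs)).
  by rewrite /n; case: (xs) s0 => //= X ys _; rewrite drop0.
have n2 : 1 < n by [].
have exI j : j < size xs ->
    excess (take j.+1 xs) = excess (take j xs) + #|nth set0 xs j|.-1.
  by move=> sj; rewrite (take_nth set0) // -cats1 excess_cat /excess /= addn0.
(* The head, made of the blocks [0] to [i - 1], injects into the blocks [1] to [k]. Adding the first
   block to both sides gives this bound, which excludes [k < i]; for [k = i] it compares block [i]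
   with the first block. *)
have le_ex : excess (take i xs) + n.-1 <= excess (take k.+1 xs).
  by rewrite exK addnC leq_add2l -ltnS -cHd -cK.
have {ki} Ek : k = i.
  apply/eqP; rewrite eqn_leq ki leqNgt; apply/negP=> ki'.
  have : excess (take k.+1 xs) <= excess (take i xs).
    have [-> //|ne] := eqVneq k.+1 i.
    by apply: ltnW; apply: (excess_take_lt ch _ (ltnW si)); rewrite ltn_neqAle ne.
  rewrite leqNgt; apply/negP; rewrite negbK; apply: leq_trans le_ex.
  by rewrite -addn1 leq_add2l -subn1 subn_gt0.
have bI := chain_blk ch (mem_nth set0 si); have [I2 _ _] := bI.
have nI : n <= #|nth set0 xs i|.
  move: le_ex; rewrite Ek exI // leq_add2l -!subn1 leq_subLR subnKC //.
  exact: ltnW.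
have IS : {subset nth set0 xs i <= S} by move=> w; apply: nthS.
have c0I : c0 \in nth set0 xs i by rewrite -Ei; case/andP: (cutv_mem r ch i0 si).
have [[y fy]|Ir] := dich _ IS bI; last by have := small _ IS bI Ir; rewrite ltnNge nI.
have xy : x = y by rewrite -(fy c0 c0I) fc0.
have /card_gt0P[w /setD1P[wc wI]] : 0 < #|nth set0 xs i :\ c0|.
  by move: I2; rewrite (cardsD1 c0) c0I ltnS.
apply: (fT w _ wc); last by rewrite xy fy.
exact: span_drop_nth (leqnn i) si wI.
Qed.

End TailGraph.

(** * Excluding the possible embeddings *)

Lemma bounded_listing (V : eqType) (Q : V -> Prop) K :
  (forall zs, uniq zs -> (forall z, z \in zs -> Q z) -> size zs <= K) ->
  exists Z : seq V, size Z <= K /\ forall z, Q z -> z \in Z.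
Proof.
move=> QK; apply: contrapT => nZ.
have big k : exists zs : seq V, [/\ uniq zs, forall z, z \in zs -> Q z & size zs = k].
  elim: k => [|k [zs [zu zQ zk]]]; first by exists [::].
  have [z Qz zn] : exists2 z, Q z & z \notin zs.
    apply: contrapT => nz; apply: nZ; exists zs; split; first exact: QK.
    by move=> z Qz; apply: contrapT => zn; apply: nz; exists z => //; apply/negP.
  exists (z :: zs); split; rewrite /= ?zn ?zk //.
  by move=> x; rewrite inE => /orP[/eqP->|/zQ].
have [zs [zu zQ zk]] := big K.+1.
by have := QK zs zu zQ; rewrite zk ltnn.
Qed.

Section NoUniversal.

Variables (T : finType) (C : sgraph T) (xs : seq {set T}) (r c c' : T) (m : nat).
Hypothesis ch : chain C xs.
Hypothesis r0 : r \in nth set0 xs 0.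
Hypothesis r1 : 1 < size xs -> r = cutv r xs 1.
Hypothesis cX : c \in nth set0 xs 0.
Hypothesis cX' : c' \in nth set0 xs 0.
Hypothesis cc' : c != c'.
Hypothesis Ccc' : ~~ C c c'.
(** The forbidden copy sends [c'] to a second completion and the tail to a fibre of the first
    embedding, so the root has to be another vertex than [c']. *)
Hypothesis rc' : r != c'.
Hypothesis Xm : #|nth set0 xs 0| = m.+2.

Let X0 := nth set0 xs 0.
Let D0 := span (drop 1 xs).

Variables (V : countType) (G : sgraph V) (M : V -> Prop).
Hypothesis Gfree : free_of C (span xs) G M.

Definition fiber_emb (f : nat * T -> V) := [/\ injective f, forall v, M (f v)
  & forall x u w, u \in D0 -> w \in D0 -> C u w -> G (f (x, u)) (f (x, w))].

(** The embedding is quantified inside, so that the completions of [s] are bounded over all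
    embeddings together. This is what lets a finite list of values cover every embedding. *)
Definition completes z s := exists f y A, [/\ fiber_emb f, uniq (y :: A),
  {in y :: A &, forall a b, a != b -> G (f (a, r)) (f (b, r))},
  f (y, r) = z & [seq f (a, r) | a <- A] = s].

(* Two completions [z1], [z2] of the same [m]-clique give a complete graph with
   the edge [z1 z2] missing; it contains the first block of [C], and the tail of
   [C] is found in a fibre unless this fibre contains [z2]. *)
Lemma completes_bound s zs : size s = m -> uniq zs ->
  (forall z, z \in zs -> completes z s) -> size zs <= #|T|.+1.
Proof.
move=> sm; case: zs => // z1 zs /= /andP[z1n zu] zc; rewrite ltnS leqNgt.
apply/negP=> zT; have [f1 [y1 [A1 [f1e yA1 cl1 Ez1 Es1]]]] := zc z1 (mem_head _ _).
have [f1i f1M f1h] := f1e.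
pose rest := enum (X0 :\ c :\ c').
have szr : size rest = m.
  rewrite -cardE; have : #|X0| = m.+2 := Xm.
  rewrite (cardsD1 c) [c \in X0]cX (cardsD1 c' (X0 :\ c)) in_setD1 eq_sym cc'.
  by rewrite [c' \in X0]cX' !add1n => -[].
have szA1 : size A1 = m by rewrite -sm -Es1 size_map.
pose qq u := if u == c then y1 else nth 0 A1 (index u rest).
(* The tail will occupy the fibre of [f1] over [qq r]. At most [#|T|] completions lie in it; with
   [z1] itself this gives the bound [#|T|.+1]. *)
have [z2 z2z z2f] : exists2 z, z \in zs & z \notin [seq f1 (qq r, u) | u <- enum T].
  apply: contrapT => nz; have : size zs <= size [seq f1 (qq r, u) | u <- enum T].
    apply: uniq_leq_size => // z zz; apply: contrapT => zn; apply: nz.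
    by exists z => //; apply/negP.
  by rewrite size_map -cardE leqNgt zT.
have [|f2 [y2 [A2 [f2e yA2 cl2 Ez2 Es2]]]] := zc z2; first by rewrite inE z2z orbT.
have [f2i f2M f2h] := f2e.
have szA2 : size A2 = m by rewrite -sm -Es2 size_map.
pose rho u := if u == c then z1 else if u == c' then z2 else nth z1 s (index u rest).
have rest_lt u : u \in X0 -> u != c -> u != c' -> index u rest < m.
  by move=> uX uc uc'; rewrite -szr index_mem mem_enum !inE uc' uc.
have rho1 u : u \in X0 -> u != c' -> rho u = f1 (qq u, r).
  move=> uX uc'; rewrite /rho /qq (negPf uc'); case: eqVneq => [_|uc] //.
  by rewrite -Es1 (nth_map 0) // szA1 rest_lt.
have rho2 u : u \in X0 -> u != c -> u != c' ->
    exists2 a, a \in A2 & rho u = f2 (a, r).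
  move=> uX uc uc'; rewrite /rho (negPf uc) (negPf uc').
  exists (nth 0 A2 (index u rest)); first by rewrite mem_nth // szA2 rest_lt.
  by rewrite -Es2 (nth_map 0) // szA2 rest_lt.
have rhoc' : rho c' = z2 by rewrite /rho eq_sym (negPf cc') eqxx.
have qmem u : u \in X0 -> u != c' -> qq u \in y1 :: A1.
  move=> uX uc'; rewrite /qq; case: eqVneq => [_|uc]; first exact: mem_head.
  by rewrite inE mem_nth ?orbT // szA1 rest_lt.
have /andP[y1A A1u] := yA1; have /andP[y2A A2u] := yA2.
have qinj u w : u \in X0 -> w \in X0 -> u != c' -> w != c' -> qq u = qq w -> u = w.
  move=> uX wX uc' wc'; rewrite /qq.
  case: (eqVneq u c) => [->|uc]; case: (eqVneq w c) => [->|wc] //.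
  - by move=> E; move: y1A; rewrite E mem_nth // szA1 rest_lt.
  - by move=> E; move: y1A; rewrite -E mem_nth // szA1 rest_lt.
  move/eqP; rewrite nth_uniq ?szA1 ?rest_lt // => /eqP E.
  have ur : u \in rest by rewrite mem_enum !inE uc' uc.
  have wr : w \in rest by rewrite mem_enum !inE wc' wc.
  by rewrite -(nth_index c ur) E nth_index.
have z2n u : u \in X0 -> u != c' -> rho u != z2.
  move=> uX uc'; have [->|uc] := eqVneq u c.
    by rewrite /rho eqxx; apply: contraNneq z1n => ->.
  have [a aA ->] := rho2 u uX uc uc'; rewrite -Ez2.
  by apply: contraNneq y2A => /f2i[<-].
pose F u := if u \in X0 then rho u else f1 (qq r, u).
have FD u : u \in D0 -> F u = f1 (qq r, u).
  move=> uD; rewrite /F; case: ifP => // uX.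
  by rewrite (root_cap ch r0 r1 uX uD) rho1.
have out u : u \in span xs -> u \notin X0 -> u \in D0.
  move=> uS uX; move: uS; rewrite (span_take_drop 1) in_setU.
  by rewrite (take1_span (size_xs_gt0 r0)) (negPf uX).
have rhoF u w : u \in X0 -> w \notin X0 -> rho u != f1 (qq r, w).
  move=> uX wX; have [->|uc'] := eqVneq u c'.
    rewrite rhoc'; apply: contraNneq z2f => ->; apply/mapP; exists w => //.
    by rewrite mem_enum.
  by rewrite rho1 //; apply: contraNneq wX => /f1i[_ <-].
have Fi : {in span xs &, injective F}.
  move=> u w uS wS; rewrite /F; case: ifP => uX; case: ifP => wX.
  - have [->|uc'] := eqVneq u c'; have [->|wc'] := eqVneq w c' => //.
    + by rewrite rhoc' => E; case/eqP: (z2n w wX wc').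
    + by rewrite rhoc' => E; case/eqP: (z2n u uX uc').
    by rewrite !rho1 // => /f1i[E]; apply: qinj.
  - by move=> E; have := rhoF u w uX (negbT wX); rewrite E eqxx.
  - by move=> E; have := rhoF w u wX (negbT uX); rewrite -E eqxx.
  - by move=> /f1i[].
have cl1c' u : u \in X0 -> C u c' -> G (rho u) z2.
  move=> uX uc'; have uc : u != c by apply: contraTneq uc' => ->.
  have ucc : u != c' by apply: contraTneq uc' => ->; rewrite adj_irr.
  have [a aA ->] := rho2 u uX uc ucc; rewrite -Ez2.
  apply: cl2; rewrite ?mem_head // ?inE ?aA ?orbT //.
  by apply: contraNneq y2A => <-.
apply: (Gfree (f := F)); split=> //.
- move=> u w uS wS uw; have [j [sj uj wj]] := chain_edge_nth ch uS wS uw.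
  have [j0|j0] := posnP j; last first.
    have uD : u \in D0 by apply: span_drop_nth uj.
    have wD : w \in D0 by apply: span_drop_nth wj.
    by rewrite !FD //; apply: f1h.
  rewrite j0 in uj wj; rewrite /F uj wj.
  have uw' : u != w by apply: contraTneq uw => ->; rewrite adj_irr.
  have [Eu|uc'] := eqVneq u c'.
    by rewrite Eu rhoc' (adj_sym G); apply: cl1c' => //; rewrite (adj_sym C) -Eu.
  have [Ew|wc'] := eqVneq w c'.
    by rewrite Ew rhoc'; apply: cl1c' => //; rewrite -Ew.
  rewrite !rho1 //; apply: cl1; rewrite ?qmem //.
  by apply: contra uw' => /eqP E; apply/eqP; apply: qinj.
- move=> u _; rewrite /F; case: ifP => // uX.
  have [->|uc'] := eqVneq u c'; first by rewrite rhoc' -Ez2.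
  by rewrite rho1.
Qed.

Definition hyper_emb es f := [/\ injective f, forall v, M (f v)
  & {homo f : p q / tail_graph C D0 r (core es) p q >-> G p q}].

Definition root_vals (f : nat * T -> V) b := [seq f (x, r) | x <- iota 0 b].

Lemma hyper_emb_sub es es' f : {subset es <= es'} -> hyper_emb es' f -> hyper_emb es f.
Proof.
move=> sub [fi fM fh]; split=> // p q pq; apply: fh; case/orP: pq => [h|].
  by apply/orP; left.
case/and3P=> h1 h2 /andP[pq /hasP[e ees he]]; apply/orP; right.
by rewrite h1 h2 /= /core_rel pq; apply/hasP; exists e; rewrite ?sub.
Qed.

Lemma hyper_emb_completes es f y A : hyper_emb es f -> y :: A \in es ->
  uniq (y :: A) -> completes (f (y, r)) [seq f (a, r) | a <- A].
Proof.
move=> [fi fM fh] es_e eu; exists f, y, A; split=> //.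
- by split=> // x u w uD wD uw; apply: fh; apply/orP; left; rewrite /= eqxx uD wD.
- move=> a b ae be ab; apply: fh; apply/orP; right; rewrite /= !eqxx /= /core_rel ab.
  by apply/hasP; exists (y :: A); rewrite ?ae.
Qed.

Lemma nth_root_vals v0 f b x : x < b -> nth v0 (root_vals f b) x = f (x, r).
Proof. by move=> xb; rewrite (nth_map 0) ?size_iota // nth_iota. Qed.

Lemma map_root_vals v0 f b A : all (fun a => a < b) A ->
  map (nth v0 (root_vals f b)) A = [seq f (a, r) | a <- A].
Proof. by move/allP=> Ab; apply/eq_in_map=> a /Ab; apply: nth_root_vals. Qed.

Lemma root_valsS f b : root_vals f b.+1 = rcons (root_vals f b) (f (b, r)).
Proof. by rewrite /root_vals -addn1 iotaD map_cat cats1. Qed.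

Variable v0 : V.

(** The value at the root over [b] completes the clique of the values over [A], which each [w] in
    [W] already records. *)
Lemma new_vertex W b A : size A = m -> all (fun a => a < b) A -> uniq (b :: A) ->
  exists W1, size W1 <= #|T|.+1 * size W /\
    forall es f, hyper_emb es f -> b :: A \in es -> root_vals f b \in W ->
      root_vals f b.+1 \in W1.
Proof.
move=> Am Ab bA.
have /choice[Z ZP] (w : seq V) : exists Z : seq V, size Z <= #|T|.+1 /\
    forall z, completes z (map (nth v0 w) A) -> z \in Z.
  by apply: bounded_listing => zs; apply: completes_bound; rewrite size_map.
exists (flatten [seq [seq rcons w z | z <- Z w] | w <- W]); split.
  rewrite mulnC -(size_map (fun w => [seq rcons w z | z <- Z w]) W).
  apply: size_flatten_le => k /mapP[s /mapP[w _ ->] ->].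
  by rewrite size_map; case: (ZP w).
move=> es f fe bes fW; apply/flattenP.
exists [seq rcons (root_vals f b) z | z <- Z (root_vals f b)]; first exact: map_f.
rewrite root_valsS; apply: map_f; apply: (ZP _).2.
by rewrite map_root_vals //; apply: hyper_emb_completes fe bes bA.
Qed.

(** [L] is the distance that [core_block] asks for, two paths of length at most [#|T|]; [K] is the
    bound of [completes_bound]. *)
Let L := 2 * #|T|.
Let K := #|T|.+1.
Let q := (K * K).+1.
Let R := num_roots m L q.

Definition alive t es g (W : seq (seq V)) := forall f, hyper_emb es f -> root_vals f R = g ->
  root_vals f (R + t) \in W.

(** The hypergraph may have been built against other initial values; for [g] the listing restarts at
    [[:: g]] and runs through all vertices added so far. *)
Lemma finite_alive t es g : stage m L q t es -> exists W, alive t es g W.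
Proof.
move=> st; suff h s : s <= t -> exists W : seq (seq V), forall f, hyper_emb es f ->
    root_vals f R = g -> root_vals f (R + s) \in W by apply: h.
elim: s => [_|s IH st'].
  by exists [:: g] => f _ <-; rewrite addn0 mem_head.
have [W WP] := IH (ltnW st').
have Rst : R + s < R + t by rewrite ltn_add2l.
have [A [Aes Al]] := stage_new st (leq_addr s R) Rst.
have [Au /= [Am] _] := stage_edge st Aes.
have [W1 [_ W1P]] := new_vertex W Am Al Au.
exists W1 => f fe fg; rewrite addnS; apply: (W1P es f fe Aes). exact: WP fe fg.
Qed.

(* A new vertex multiplies the number of possible values by at most [K]; the
   choice among [q > K * K] ways of adding a further hyperedge divides it by
   at least [q / K] for one of the choices. *)
Lemma alive_step t es g W : stage m L q t es -> alive t es g W -> 0 < size W ->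
  exists es' W', [/\ stage m L q t.+1 es', {subset es <= es'}, alive t.+1 es' g W'
    & size W' < size W].
Proof.
move=> st aW W0; have [A [A' [js [[Am bA Ab] [Am' jq ju jP]]]]] := stage_step st.
rewrite -/R in bA Ab jP.
pose es_ j := (j :: A') :: (R + t :: A) :: es.
have [W1 [W1s W1P]] := new_vertex W Am Ab bA.
pose P j w := `[< exists f, hyper_emb (es_ j) f /\ root_vals f (R + t).+1 = w >].
have sub j : {subset es <= es_ j} by move=> e ees; rewrite !inE ees !orbT.
have aj j : alive t.+1 (es_ j) g [seq w <- W1 | P j w].
  move=> f fe fg; rewrite addnS mem_filter; apply/andP; split.
    by apply/asboolP; exists f.
  apply: (W1P _ f fe); first by rewrite !inE eqxx orbT.
  exact: aW (hyper_emb_sub (sub j) fe) fg.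
(* For a fixed [w], the values at the surviving [j] complete one clique over [A'], and they are
   distinct because [w] comes from an injective map. *)
have cnt w : count (P^~ w) js <= K.
  rewrite -size_filter; case E: (filter _ _) => [|j1 s] //; rewrite -E.
  have /hasP[j2 j2j /asboolP[f [fe fw]]] : has (P^~ w) js.
    by rewrite has_filter E.
  have [fi _ _] := fe.
  rewrite -(size_map (nth v0 w)).
  apply: (@completes_bound (map (nth v0 w) A')); first by rewrite size_map.
    rewrite map_inj_in_uniq ?filter_uniq // => i j; rewrite !mem_filter.
    case/andP=> _ /jP[_ /= /andP[ib _] _] /andP[_ /jP[_ /= /andP[jb _] _]].
    by rewrite -fw !nth_root_vals ?ltnS ?(ltnW ib) ?(ltnW jb) // => /fi[].
  move=> z /mapP[j]; rewrite mem_filter => /andP[/asboolP[f' [fe' fw']] jj] ->.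
  have [uj /= /andP[jb A'b] _] := jP j jj.
  rewrite -fw' nth_root_vals ?ltnS ?(ltnW jb) // map_root_vals; last first.
    by apply: sub_all A'b => a /ltnW.
  by apply: hyper_emb_completes fe' _ uj; rewrite mem_head.
have [j [jj jW]] : exists j, j \in js /\ size [seq w <- W1 | P j w] < size W.
  apply: contrapT => nj.
  have lo : q * size W <= \sum_(j <- js) count (P j) W1.
    have -> : q * size W = \sum_(j <- js) size W.
      by rewrite big_const_seq count_predT iter_addn_0 jq mulnC.
    rewrite [leqLHS]big_seq [leqRHS]big_seq; apply: leq_sum => j jj.
    rewrite leqNgt; apply/negP=> h; apply: nj; exists j; split=> //.
    by rewrite size_filter.
  have hi : \sum_(j <- js) count (P j) W1 <= K * size W1.
    under eq_bigr => j _ do rewrite -sum1_count big_mkcond /=.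
    rewrite exchange_big /=.
    have -> : K * size W1 = \sum_(w <- W1) K.
      by rewrite big_const_seq count_predT iter_addn_0.
    by apply: leq_sum => w _; rewrite -big_mkcond sum1_count cnt.
  have h := leq_trans lo (leq_trans hi (leq_mul (leqnn K) W1s)).
  by move: h; rewrite mulnA leq_pmul2r // ltnn.
by exists (es_ j), [seq w <- W1 | P j w]; split=> //; case: (jP j jj).
Qed.

Lemma kill t es g : stage m L q t es -> exists t' es', [/\ stage m L q t' es',
  {subset es <= es'} & forall f, hyper_emb es' f -> root_vals f R <> g].
Proof.
move=> st; have [W aW] := finite_alive g st.
have [k Wk] : exists k, size W <= k by exists (size W).
elim: k t es W st aW Wk => [|k IH] t es W st aW Wk.
  exists t, es; split=> // f fe fg; move: (aW f fe fg).
  by move: Wk; rewrite leqn0 size_eq0 => /eqP->.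
have [W0|W0] := posnP (size W); first by apply: IH st aW _; rewrite W0.
have [es' [W' [st' sub aW' lt]]] := alive_step st aW W0.
have [|t'' [es'' [st'' sub' h]]] := IH _ _ _ st' aW'; first by rewrite -ltnS (leq_trans lt).
by exists t'', es''; split=> // e /sub/sub'.
Qed.

Lemma not_universal : ~ forall (W : countType) (H : sgraph W),
  free_of C (span xs) H (fun=> True) ->
  exists g : W -> V, [/\ injective g, {homo g : x y / H x y >-> G x y}
                       & forall w, M (g w)].
Proof.
move=> univ.
pose state := {s : nat * seq (seq nat) | stage m L q s.1 s.2}.
(* Step [i] extends the hypergraph to defeat the tuple with code [i]; a number that codes no tuple
   changes nothing. *)
have /choice[next nextP] (is_ : nat * state) : exists s' : state,
    {subset (sval is_.2).2 <= (sval s').2} /\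
    forall g, unpickle is_.1 = Some g ->
      forall f, hyper_emb (sval s').2 f -> root_vals f R <> g.
  case: is_ => i [[t es] st] /=; case: (unpickle i) => [g|]; last first.
    by exists (exist _ (t, es) st); split.
  have [t' [es' [st' sub h]]] := kill g st.
  by exists (exist _ (t', es') st'); split=> // _ [<-].
pose st_ := fix st_ i : state :=
  if i is i'.+1 then next (i', st_ i') else exist _ (0, [::]) (stage0 m L q).
pose es_ i := (sval (st_ i)).2.
have es_sub i j : i <= j -> {subset es_ i <= es_ j}.
  elim: j => [|j IH]; first by rewrite leqn0 => /eqP->.
  rewrite leq_eqVlt => /orP[/eqP->//|/IH sub] e /sub.
  by case: (nextP (j, st_ j)) => h _; apply: h.
pose lim : rel nat := fun x y => `[< exists i, core (es_ i) x y >].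
have lim_sym : symmetric lim.
  by move=> x y; apply/asboolP/asboolP => -[i h]; exists i; rewrite adj_sym.
have lim_irr : irreflexive lim.
  by move=> x; apply/asboolP => -[i]; rewrite adj_irr.
have core_mono i j x y : i <= j -> core (es_ i) x y -> core (es_ j) x y.
  move=> ij /andP[xy /hasP[e ee he]]; rewrite /= /core_rel xy.
  by apply/hasP; exists e; rewrite ?(es_sub i j).
pose H := tail_graph C D0 r (SGraph lim_sym lim_irr).
have [|g [gi gh gM]] := univ _ H.
  move=> f [fi fh _].
  (* A copy of [C] has finitely many edges, so it is already present at one stage, where
     [tail_graph_free] applies. *)
  have [j jP] : exists j : T * T -> nat, forall uw, uw.1 \in span xs ->
      uw.2 \in span xs -> C uw.1 uw.2 ->
      tail_graph C D0 r (core (es_ (j uw))) (f uw.1) (f uw.2).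
    apply: (fin_all_exists (P := fun uw j => uw.1 \in span xs -> uw.2 \in span xs ->
      C uw.1 uw.2 -> tail_graph C D0 r (core (es_ j)) (f uw.1) (f uw.2))) => -[u w] /=.
    have [[uS [wS uw]]|n] := pselect (u \in span xs /\ w \in span xs /\ C u w).
      have := fh u w uS wS uw; case/orP=> [h|/and3P[h1 h2 /asboolP[i hi]]].
        by exists 0 => _ _ _; apply/orP; left.
      by exists i => _ _ _; apply/orP; right; rewrite h1 h2.
    by exists 0 => h1 h2 h3; case: n.
  pose i := \max_uw j uw.
  have st : stage m L q (sval (st_ i)).1 (es_ i) := svalP (st_ i).
  apply: (tail_graph_free ch r0 r1 (leqnn L) (stage_acyc st) _ (f := f)).
    by move=> e /(stage_edge st)[_ -> _]; rewrite Xm.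
  split=> // u w uS wS uw; have /orP[h|/and3P[h1 h2 h3]] := jP (u, w) uS wS uw.
    by apply/orP; left.
  apply/orP; right; rewrite h1 h2; apply: core_mono h3.
  exact: (@leq_bigmax _ j (u, w)).
(* The initial values of [g] were excluded at the step numbered by their own code, and the limit
   contains the hypergraph of that step. *)
have [_ h] := nextP (pickle (root_vals g R), st_ (pickle (root_vals g R))).
apply: (h (root_vals g R) (pickleK _) g _ erefl); split=> // p p' pp'; apply: gh.
case/orP: pp' => [h'|/and3P[h1 h2 h3]]; first by apply/orP; left.
apply/orP; right; rewrite h1 h2; apply/asboolP.
by exists (pickle (root_vals g R)).+1.
Qed.

End NoUniversal.

(** * Blocks of a block path *)

Section Reduction.

Variables (T : finType) (C : sgraph T).
Implicit Types (X Y D : {set T}) (xs ys : seq {set T}).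

(** The ends of the missing edge play symmetric roles, so one that differs from the root can serve
    as [c']. *)
Lemma noncomplete_first xs c c' : chain C xs -> c \in nth set0 xs 0 ->
  c' \in nth set0 xs 0 -> c != c' -> ~~ C c c' -> ~ has_universal C xs.
Proof.
move=> ch cX cX' cc' Ccc' [V [G [M [Gf univ]]]].
have s0 : 0 < size xs := size_xs_gt0 cX.
pose r := if 1 < size xs then cutv c xs 1 else c.
have r0 : r \in nth set0 xs 0.
  by rewrite /r; case: ifP => // s1; case/andP: (cutv_mem c ch (a := 1) isT s1).
have r1 : 1 < size xs -> r = cutv r xs 1.
  move=> s1; apply/eqP; have := cutvP r ch (a := 1) isT s1.
  by rewrite (cutvP c ch) // => /setP/(_ r); rewrite {1}/r s1 !inE eqxx => <-.
have [m Xm] : exists m, #|nth set0 xs 0| = m.+2.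
  have [X2 _ _] := chain_blk ch (mem_nth set0 s0).
  by case: #|_| X2 => [|[|m]] // _; exists m.
(* [v0] serves as a default for [nth]; universality for the tail graph without hyperedges shows that
   [V] is inhabited. *)
have [v0 _] : exists v0 : V, True.
  have [|g _] := univ _ (tail_graph C (span (drop 1 xs)) r (core [::])).
    exact: (tail_graph_free ch r0 r1 (L := 2 * #|T|) (leqnn _)).
  by exists (g (0, r)).
have [E|rc'] := eqVneq r c'; last first.
  exact: (not_universal ch r0 r1 cX cX' cc' Ccc' rc' Xm Gf v0 univ).
have rc : r != c by rewrite E eq_sym.
rewrite eq_sym in cc'; rewrite (adj_sym C) in Ccc'.
exact: (not_universal ch r0 r1 cX' cX cc' Ccc' rc Xm Gf v0 univ).
Qed.

(** [X] itself is never pruned: while it is interior, the smaller end goes, or both ends if they are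
    equal; once it is an end, reversal can put it first. *)
Lemma noncomplete_block xs X c c' : chain C xs -> X \in xs -> c \in X ->
  c' \in X -> c != c' -> ~~ C c c' -> ~ has_universal C xs.
Proof.
move=> ch Xxs cX cX' cc' Ccc'; have [k sk] : exists k, size xs <= k by exists (size xs).
elim: k xs ch Xxs sk => [|k IH] xs ch Xxs sk; first by case: (xs) Xxs sk.
case: xs ch Xxs sk => // A xs ch; rewrite inE => /orP[/eqP EA _|Xxs].
  by apply: (noncomplete_first (c := c) (c' := c') ch); rewrite //= -EA.
case: (lastP xs) Xxs ch => // {xs} ys Y; rewrite mem_rcons inE => XY ch sk.
have revE : rev (A :: rcons ys Y) = Y :: rcons (rev ys) A.
  by rewrite rev_cons rev_rcons rcons_cons.
case/orP: XY => [/eqP EY|Xys].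
  move/has_universal_rev; apply: (noncomplete_first (c := c) (c' := c') (chain_rev ch));
    by rewrite // revE /= -EY.
have sk' : size (rcons ys Y) <= k by move: sk.
case: (ltngtP #|A| #|Y|) => AY hU.
- have ch' := chain_drop 1 ch; rewrite /= drop0 in ch'.
  apply: (IH _ ch' _ sk' (prune_first ch AY hU)).
  by rewrite mem_rcons inE Xys orbT.
- have := has_universal_rev hU; have := chain_rev ch; rewrite revE => chr hUr.
  have ch' := chain_drop 1 chr; rewrite /= drop0 in ch'.
  apply: (IH _ ch' _ _ (prune_first chr AY hUr)).
    by rewrite mem_rcons inE mem_rev Xys orbT.
  by move: sk'; rewrite !size_rcons size_rev.
- have ch' := chain_take (size ys) (chain_drop 1 ch).
  rewrite /= drop0 -cats1 take_size_cat // in ch'.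
  have s0 : 0 < size ys by case: (ys) Xys.
  apply: (IH _ ch' Xys _ (prune_both ch s0 AY hU)).
  by apply: leq_trans sk'; rewrite size_rcons.
Qed.

End Reduction.

(** * From blocks as subgraphs to chains of vertex sets *)

Section Blocks.

Variables (T : finType) (C : sgraph T).
Implicit Types (H K : presubgraph T).

Lemma edge_rel_sym H : symmetric (edge_rel H).
Proof. by move=> x y; rewrite /edge_rel setUC. Qed.

Lemma edge_whole x y : edge_rel (whole C) x y = C x y.
Proof.
apply/imsetP/idP => [[[a b]]|xy]; last by exists (x, y); rewrite ?inE.
rewrite !inE /= => ab E.
have ab' : a != b by apply: contraTneq ab => ->; rewrite adj_irr.
have aE : a \in [set x; y] by rewrite E !inE eqxx.
have bE : b \in [set x; y] by rewrite E !inE eqxx orbT.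
have : x \in [set a; b] by rewrite -E !inE eqxx.
have : y \in [set a; b] by rewrite -E !inE eqxx orbT.
rewrite !inE => /orP[]/eqP Ey /orP[]/eqP Ex; rewrite Ex Ey // in aE bE *.
- by case/negP: ab'; move: bE; rewrite !inE orbb eq_sym.
- by rewrite adj_sym.
- by case/negP: ab'; move: aE; rewrite !inE orbb.
Qed.

Lemma edge_rel_sub H x y : is_subgraph C H -> edge_rel H x y ->
  [/\ C x y, x \in vertices H & y \in vertices H].
Proof.
move=> [/andP[_ /subsetP sub] ends] xy.
have /subsetP e := ends _ xy.
by split; [rewrite -edge_whole; apply: sub|apply: e; rewrite !inE eqxx|
  apply: e; rewrite !inE eqxx orbT].
Qed.

Lemma edge_del_vertex H v x y : edge_rel (del_vertex H v) x y ->
  [/\ edge_rel H x y, x != v & y != v].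
Proof.
rewrite /edge_rel !inE negb_or => /andP[h /andP[h1 h2]].
by split; rewrite // eq_sym.
Qed.

Lemma conn_of_connect (X : {set T}) (E : rel T) :
  (forall x y, E x y -> [/\ C x y, x \in X & y \in X]) ->
  {in X &, forall x y, connect E x y} -> conn C X.
Proof.
move=> EC cE P v w vX wX Pv cl; case/connectP: (cE v w vX wX) => p.
elim: p v vX Pv => [|x p IH] v vX Pv /=; first by move=> _ ->.
case/andP=> /EC[vx _ xX] xp wE; apply: (IH x) => //.
exact: cl vx Pv.
Qed.

Lemma blk_two_connected H : is_subgraph C H -> two_connected H -> blk C (vertices H).
Proof.
move=> sH [H2 [_ cH] cHd].
have cV : conn C (vertices H).
  by apply: conn_of_connect cH => x y; apply: edge_rel_sub.
split=> // [|v]; first exact: ltnW.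
have [vH|vH] := boolP (v \in vertices H); last first.
  rewrite (_ : vertices H :\ v = vertices H) //; apply/setP=> x; rewrite !inE.
  by case: eqVneq => [->|//]; rewrite (negPf vH).
have [_ cv] := cHd v vH; apply: conn_of_connect cv => x y.
case/edge_del_vertex=> /(edge_rel_sub sH)[xy xH yH] xv yv.
by rewrite !inE xv yv.
Qed.

Lemma blk_edge x y : C x y -> blk C [set x; y].
Proof.
move=> xy; have cn (X : {set T}) : X \subset [set x; y] -> conn C X.
  move=> /subsetP sX P v w vX wX Pv cl; have := sX v vX; have := sX w wX.
  rewrite !inE => /orP[]/eqP Ew /orP[]/eqP Ev; rewrite Ew ?Ev in vX wX *; rewrite Ev in Pv vX.
  - by [].
  - by apply: (cl y) => //; rewrite adj_sym.
  - exact: (cl x).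
  - by [].
have xy' : x != y by apply: contraTneq xy => ->; rewrite adj_irr.
split; first by rewrite cards2 xy'.
  exact: cn.
by move=> c; apply: cn; apply: subsetDl.
Qed.

Lemma blk_block H : is_block C H -> blk C (vertices H).
Proof.
case=> [[sH tH _]|[x [y [xy _ ->]]]]; first exact: blk_two_connected.
exact: blk_edge.
Qed.

Lemma connect_path (E : rel T) w q : symmetric E -> path C w q ->
  {in w :: q &, forall a b, C a b -> E a b} ->
  {in w :: q &, forall a b, connect E a b}.
Proof.
move=> sE wq CE a b aq bq.
have Ewq : path E w q by apply: (sub_in_path (P := mem (w :: q))) wq => //; apply/allP.
apply: connect_trans (path_connect Ewq bq).
by rewrite (sym_connect_sym sE); apply: path_connect Ewq _ aq.
Qed.

Definition induced (X : {set T}) : presubgraph T :=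
  (X, [set e in edges (whole C) | e \subset X]).

Lemma induced_subgraph (X : {set T}) : is_subgraph C (induced X).
Proof.
split; last by move=> e; rewrite inE => /andP[].
by rewrite /subgraph_le subsetT; apply/subsetP=> e; rewrite inE => /andP[].
Qed.

Lemma induced_edge (X : {set T}) x y : x \in X -> y \in X -> C x y -> edge_rel (induced X) x y.
Proof.
move=> xX yX xy; rewrite /edge_rel inE; apply/andP; split.
  by move: xy; rewrite -edge_whole.
by apply/subsetP=> z; rewrite !inE => /orP[]/eqP->.
Qed.

Lemma cycle_two_connected s : 2 < size s -> ucycle C s ->
  two_connected (induced [set x in s]).
Proof.
move=> s2 /andP[cs us]; set X := [set x in s].
split; first by rewrite /vertices /= /X cardsE (card_uniqP us).
  case: s s2 cs us @X => // x q s2 cs us X; split.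
    by apply/set0Pn; exists x; rewrite !inE eqxx.
  move: cs; rewrite /= rcons_path => /andP[xq _] a b; rewrite !inE => aq bq.
  apply: (connect_path (@edge_rel_sym _) xq); rewrite ?inE // => c d cq dq.
  by apply: induced_edge; rewrite inE.
(* Rotated to begin at the deleted vertex, the cycle leaves a path through the others. *)
move=> v; rewrite inE => vs; case: (rot_to vs) => i q E.
have qs c : c \in q -> c \in s by move=> cq; rewrite -(mem_rot i) E inE cq orbT.
have uq : uniq (v :: q) by rewrite -E rot_uniq.
have sq c : (c \in X :\ v) = (c \in q).
  rewrite !inE -(mem_rot i) E inE; case: eqVneq => //= ->.
  by case/andP: uq => /negPf->.
have cq : cycle C (v :: q) by rewrite -E rot_cycle.
have q2 : 1 < size q by move: s2; rewrite -(size_rot i s) E.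
have {}sq c : (c \in vertices (del_vertex (induced X) v)) = (c \in q) by rewrite sq.
case: q E qs uq sq cq q2 => // w q E qs uq sq cq q2; split.
  by apply/set0Pn; exists w; rewrite sq mem_head.
move: cq; rewrite /= rcons_path => /and3P[_ wq _] a b; rewrite !sq => aq bq.
apply: (connect_path (@edge_rel_sym _) wq) => // c d cq dq cd.
have nv z : z \in w :: q -> v != z.
  by move=> zq; apply: contraTneq uq => ->; rewrite /= zq.
rewrite /edge_rel inE; apply/andP; split.
  by apply: induced_edge; rewrite ?inE ?qs.
by rewrite !inE negb_or !nv.
Qed.

Lemma max_two_connected_above H : is_subgraph C H -> two_connected H ->
  exists2 K, is_block C K & subgraph_le H K.
Proof.
move=> sH tH.
pose P K := `[< [/\ is_subgraph C K, two_connected K & subgraph_le H K] >].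
have PH : P H by apply/asboolP; split=> //; rewrite /subgraph_le !subxx.
(* Vertices and edges are counted together, so that a subgraph above a maximiser can gain
   neither. *)
pose M K := #|vertices K| + #|edges K|.
case: (arg_maxnP M PH) => K /asboolP[sK tK HK] Kmax.
exists K => //; left; split=> // K' sK' tK' KK'; have [le1 le2] := andP KK'.
have /Kmax le : P K'.
  apply/asboolP; split=> //; have [h1 h2] := andP HK.
  by rewrite /subgraph_le (subset_trans h1 le1) (subset_trans h2 le2).
have l1 := subset_leq_card le1; have l2 := subset_leq_card le2.
have e1 : vertices K = vertices K'.
  apply/eqP; rewrite eqEcard le1 leqNgt; apply/negP=> lt.
  by have := leq_trans (leq_add lt l2) le; rewrite addSn ltnn.
have e2 : edges K = edges K'.
  apply/eqP; rewrite eqEcard le2 leqNgt; apply/negP=> lt.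
  by have := leq_trans (leq_add l1 lt) le; rewrite addnS ltnn.
by rewrite [K]surjective_pairing [K']surjective_pairing; congr pair.
Qed.

Lemma edge_in_block x y : C x y ->
  exists H, [/\ is_block C H, x \in vertices H & y \in vertices H].
Proof.
move=> xy; have [[z [p cyc]]|nc] := pselect (edge_on_cycle C x y).
  have [//|K bK /andP[/subsetP sub _]] :=
    max_two_connected_above (induced_subgraph _) (cycle_two_connected _ cyc).
  by exists K; split=> //; apply: sub; rewrite !inE eqxx ?orbT.
exists ([set x; y], [set [set x; y]]); split; rewrite ?inE ?eqxx ?orbT //.
by right; exists x, y.
Qed.

(** Adding an edge between two of its vertices keeps a subgraph 2-connected, so a maximal one has it
    already. This links completeness of a block, which is about its own edges, to adjacency in
    [C]. *)
Lemma block_induced H x y : is_block C H -> x \in vertices H -> y \in vertices H ->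
  C x y -> edge_rel H x y.
Proof.
move=> [[sH [H2 cH cHd] Hmax]|[a [b [ab _ ->]]]] xH yH xy; last first.
  have : x != y by apply: contraTneq xy => ->; rewrite adj_irr.
  move: xH yH; rewrite /edge_rel !inE => /orP[]/eqP-> /orP[]/eqP->; rewrite ?eqxx //.
  by rewrite setUC.
pose K : presubgraph T := (vertices H, [set x; y] |: edges H).
have sub v : subrel (edge_rel (del_vertex H v)) (edge_rel (del_vertex K v)).
  by move=> a b; rewrite /edge_rel !inE => /andP[-> ->]; rewrite orbT.
have HK : subgraph_le H K by rewrite /subgraph_le subxx subsetUr.
suff <- : K = H by rewrite /edge_rel !inE eqxx.
apply: Hmax => //.
  have [/andP[s1 s2] ends] := sH; split.
    rewrite /subgraph_le s1 /= subUset s2 andbT sub1set.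
    by move: xy; rewrite -edge_whole.
  move=> e; rewrite !inE => /orP[/eqP->|/ends//].
  by apply/subsetP=> z; rewrite !inE => /orP[]/eqP->.
split=> //.
  have [h0 h] := cH; split=> // a b aH bH.
  apply: connect_sub (h a b aH bH) => c d cd; apply: connect1.
  by rewrite /edge_rel !inE; apply/orP; right.
move=> v vH; have [h0 h] := cHd v vH; split=> // a b aH bH.
by apply: connect_sub (h a b aH bH) => c d cd; apply: connect1; apply: sub.
Qed.

Lemma block_path_chain : block_path C -> exists xs : seq {set T},
  [/\ chain C xs, span xs = [set: T] & forall H, is_block C H -> vertices H \in xs].
Proof.
move=> [cC [l [B [v [[_ blkB] _ capB disjB]]]]].
pose xs := [seq vertices (B i) | i <- enum 'I_l.+1].
have Bxs H : is_block C H -> vertices H \in xs.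
  by case/blkB=> i ->; apply: map_f; rewrite mem_enum.
have bxs X : X \in xs -> blk C X.
  by case/mapP=> i _ ->; apply: blk_block; apply/blkB; exists i.
have nthB a : a < l.+1 -> nth set0 xs a = vertices (B (inord a)).
  move=> al; rewrite (nth_map (inord a)) ?size_enum_ord //; congr (vertices (B _)).
  by apply: val_inj; rewrite /= nth_enum_ord // inordK.
have edge u w : C u w -> exists X, [/\ X \in xs, u \in X & w \in X].
  by case/edge_in_block=> H [/Bxs HX uH wH]; exists (vertices H).
exists xs; split=> //.
- split=> //; last by move=> u w _ _; apply: edge.
  move=> a b; rewrite size_map size_enum_ord => /andP[ab bl].
  rewrite !nthB ?(ltn_trans ab) //.
  case: (ltngtP b a.+1) => [h|h|h]; first by lia.
    have := disjB (inord a) (inord b); rewrite !inordK ?(ltn_trans ab) // => /(_ h).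
    by move/disjoint_setI0->; rewrite cards0.
  have al : a < l by lia.
  have := capB (Ordinal al).
  have -> : widen_ord (leqnSn l) (Ordinal al) = inord a.
    by apply: val_inj; rewrite /= inordK // ltnW.
  have -> : lift ord0 (Ordinal al) = inord b.
    by apply: val_inj; rewrite /= inordK // h.
  by move=> ->; rewrite cards1.
apply/setP=> u; rewrite in_setT.
(* A block supplies a second vertex; connectedness then gives [u] an edge, and that edge lies in
   some block. *)
have [w wu] : exists w, w != u.
  have B0 : nth set0 xs 0 \in xs by rewrite mem_nth // size_map size_enum_ord.
  have [X2 _ _] := bxs _ B0.
  have : 0 < #|nth set0 xs 0 :\ u|.
    rewrite -ltnS; apply: leq_trans X2 _.
    by rewrite (cardsD1 u) -[leqRHS]add1n leq_add2r leq_b1.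
  by case/card_gt0P=> w /setD1P[wu _]; exists w.
have [_ /(_ u w) ] := cC; rewrite !in_setT => /(_ isT isT) /connectP[[|x p] /=].
  by move=> _ E; rewrite E eqxx in wu.
rewrite edge_whole => /andP[/edge[X [Xs uX _]] _] _.
exact: mem_span uX.
Qed.

End Blocks.

Theorem mainTheorem1 (T : finType) (C : sgraph T) (hC : block_path C)
    (hU : exists (V : countType) (G : sgraph V), weakly_universal C G) :
  forall B : presubgraph T, is_block C B -> is_complete B.
Proof.
move=> B bB x y xB yB xy; have [xs [ch xsT Bxs]] := block_path_chain hC.
apply/negPn/negP=> nxy; have [V [G [Gf univ]]] := hU.
apply: (noncomplete_block ch (Bxs B bB) xB yB xy).
  by apply: contra nxy; apply: block_induced.
exists V, G, (fun=> True); rewrite xsT; split.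
  by move=> f [fi fh _]; apply: Gf; exists f; split=> [a b|a b]; [apply: fi|apply: fh];
     rewrite inE.
move=> W H Hf; have [|g [gi gh]] := univ W H; last by exists g.
by move=> [f [fi fh]]; apply: (Hf f); split=> // a b _ _; [apply: fi|apply: fh].
Qed.
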